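(* Let $A\in\mathbb{R}^{m\times n}$ have rank $m$, $b\in\mathbb{R}^m$, $c\in\mathbb{R}^n$, and consider the linear program $\min\{c^Tx : Ax=b,\ x\ge 0\}$. There exists a pivot rule for the simplex algorithm such that, at any non-optimal extreme point solution $x$ of this linear program, the number of consecutive degenerate simplex pivots performed at $x$ is at most $n-m-1$. Moreover, the pivot rule can be efficiently implemented whenever an improving feasible direction at a non-optimal extreme point is available.
   Context: Setting: $[n]=\{1,\dots,n\}$. For $B\subseteq[n]$, $A_B$ is the submatrix of $A$ of columns indexed by $B$, and $x_B$ the subvector of $x$ indexed by $B$. A basis is a set $B\subseteq[n]$ with $|B|=m$ and $A_B$ non-singular; put $N=[n]\setminus B$. Its basic solution is $x$ with $x_B=A_B^{-1}b$, $x_N=0$; $B$ and $x$ are feasible if $x_B\ge 0$. The extreme point solutions are exactly the basic feasible solutions; one extreme point may have several associated feasible bases. Let $\overline{A}=A_B^{-1}A_N$ (rows indexed by $B$, columns by $N$) and $\overline{c}_N^T=c_N^T-c_B^T\overline{A}$ (reduced costs). A basis with $\overline{c}_N\ge 0$ is optimal. Simplex pivot: from a feasible basis $B$ with basic solution $x$, choose an entering index $f\in N$ with $\overline{c}_{N,f}<0$, and a leaving index $i\in B$ minimizing $x_i/\overline{A}_{if}$ among all $i\in B$ with $\overline{A}_{if}>0$ (if there is no such $i$, the LP is unbounded and the algorithm terminates); replace $B$ by $(B\setminus\{i\})\cup\{f\}$. The pivot is degenerate if the attained minimum ratio is $0$ (so $x$ does not change), and non-degenerate otherwise. Only pivots with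 negative reduced cost of the entering index count as simplex pivots. Pivot rule: a rule that selects the entering and the leaving index at each iteration of the simplex algorithm; it may use additional information kept from iteration to iteration (such as a vector that is updated). Improving feasible direction at $x$: a vector $y\in\mathbb{R}^n$ with $Ay=0$, $c^Ty<0$, and $x+\varepsilon y\ge 0$ for all sufficiently small $\varepsilon>0$. ''Efficiently implemented'' means: given such a $y$ at the extreme point, each choice of entering and leaving index (and any update of the stored information) at that extreme point takes a number of arithmetic operations polynomial in $n$ and $m$. *)

(* Defs.v *)
From HB Require Import structures.
From mathcomp Require Import all_boot all_order all_algebra.
From mathcomp Require Import reals.

Set Implicit Arguments.
Unset Strict Implicit.
Unset Printing Implicit Defensive.

Import Order.TTheory GRing.Theory Num.Theory.
Local Open Scope ring_scope.

(** * Linear programs in standard equality form *)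

Section LinearProgram.
Context {R : realType} {m n : nat}.
Implicit Types (A : 'M[R]_(m, n)) (b : 'cV[R]_m) (c x y : 'cV[R]_n).

Definition nonneg x : Prop := forall j, 0 <= x j 0.

Definition objective c x : R := (c^T *m x) 0 0.

Definition lp_feasible A b x : Prop := A *m x = b /\ nonneg x.

Definition lp_optimal A b c x : Prop :=
  lp_feasible A b x /\
  forall z, lp_feasible A b z -> objective c x <= objective c z.

Definition extreme_point A b x : Prop :=
  lp_feasible A b x /\
  forall u v (t : R), lp_feasible A b u -> lp_feasible A b v -> 0 < t < 1 ->
    x = t *: u + (1 - t) *: v -> u = x /\ v = x.

Definition improving_direction A c x y : Prop :=
  [/\ A *m y = 0, objective c y < 0 &
      exists2 e0 : R, 0 < e0 & forall e, 0 < e <= e0 -> nonneg (x + e *: y)].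

End LinearProgram.

(** * Bases *)

(* The increasing enumeration of [B], which orders the columns of [A_B]. *)
Definition bidx (m n : nat) (B : {set 'I_n}) (cardB : #|B| = m) (k : 'I_m) :
  'I_n := enum_val (cast_ord (esym cardB) k).

Record basis (R : realType) (m n : nat) (A : 'M[R]_(m, n)) := Basis {
  bset :> {set 'I_n};
  bcard : #|bset| = m;
  bnonsing : colsub (bidx bcard) A \in unitmx
}.

Section Pivots.
Context {R : realType} {m n : nat} {A : 'M[R]_(m, n)}.
Implicit Types (b : 'cV[R]_m) (c : 'cV[R]_n) (B : basis A) (f i : 'I_n).

Definition bmx B : 'M[R]_m := colsub (bidx (bcard B)) A.

(* Objects with rows indexed by [B] are padded with zero rows outside [B], so
   that their rows are indexed by ['I_n]. *)
Definition pad B (p : nat) (X : 'M[R]_(m, p)) : 'M[R]_(n, p) :=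
  (rowsub (bidx (bcard B)) 1%:M)^T *m X.

(* x_B = A_B^-1 b and x_N = 0. *)
Definition bsol b B : 'cV[R]_n := pad B (invmx (bmx B) *m b).

Definition bfeasible b B : Prop := nonneg (bsol b B).

(* The entry (i, f) is the one of A_B^-1 A_N when [i \in B] and [f \notin B]. *)
Definition Abar B : 'M[R]_n := pad B (invmx (bmx B) *m A).

(* Because of the padding, [c^T *m Abar B] is c_B^T A_B^-1 A. *)
Definition redcost c B : 'rV[R]_n := c^T - c^T *m Abar B.

Definition boptimal c B : Prop := forall f, f \notin B -> 0 <= redcost c B 0 f.

Definition can_enter c B f : Prop := f \notin B /\ redcost c B 0 f < 0.

Definition ratio b B f i : R := bsol b B i 0 / Abar B i f.

Definition can_leave b B f i : Prop :=
  [/\ i \in B, 0 < Abar B i f &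
      forall j, j \in B -> 0 < Abar B j f -> ratio b B f i <= ratio b B f j].

Definition unbounded_column B f : Prop :=
  forall i, i \in B -> ~ 0 < Abar B i f.

End Pivots.

(** * Pivot rules and runs of the simplex algorithm *)

(* [leave B s] is [None] exactly when the ratio test has no candidate, and then
   the algorithm stops, the program being unbounded. *)
Record pivot_rule (R : realType) (m n : nat)
    (A : 'M[R]_(m, n)) (b : 'cV[R]_m) (c : 'cV[R]_n) := PivotRule {
  info : Type;
  info0 : info;
  enter : basis A -> info -> option 'I_n;
  leave : basis A -> info -> option 'I_n;
  update : basis A -> info -> info;
  enterP : forall B s, bfeasible b B ->
    match enter B s with
    | Some f => can_enter c B f
    | None => boptimal c B
    end;
  leaveP : forall B s f, bfeasible b B -> enter B s = Some f ->
    match leave B s with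
    | Some i => can_leave b B f i
    | None => unbounded_column B f
    end
}.

Section Runs.
Context {R : realType} {m n : nat}.
Context {A : 'M[R]_(m, n)} {b : 'cV[R]_m} {c : 'cV[R]_n}.
Variable rule : pivot_rule A b c.
Implicit Types (B : basis A) (s : info rule).

(* The pivot made from [B] with information [s] leads to [B'], and the attained
   minimum ratio is [r]; the new information is [update B s]. *)
Definition simplex_step B s B' (r : R) : Prop :=
  exists f i, [/\ enter B s = Some f, leave B s = Some i,
                  bset B' = f |: (bset B :\ i) & r = ratio b B f i].

Inductive reachable : basis A -> info rule -> Prop :=
| reachable_start B : bfeasible b B -> reachable B (info0 rule)
| reachable_step B s B' r :
    reachable B s -> simplex_step B s B' r -> reachable B' (update B s).

(* The next [k] pivots made from [B] with information [s] are degenerate. *)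
Inductive degenerate_pivots : nat -> basis A -> info rule -> Prop :=
| degenerate_pivots0 B s : degenerate_pivots 0 B s
| degenerate_pivotsS k B s B' :
    simplex_step B s B' 0 -> degenerate_pivots k B' (update B s) ->
    degenerate_pivots k.+1 B s.

(* The algorithm starts, or has just made a non-degenerate pivot. *)
Inductive arrival : basis A -> info rule -> Prop :=
| arrival_start B : bfeasible b B -> arrival B (info0 rule)
| arrival_step B s B' r :
    reachable B s -> simplex_step B s B' r -> r <> 0 ->
    arrival B' (update B s).

End Runs.

(** * Arithmetic programs *)

(* A random access machine with real arrays and natural number arrays, both in
   unit cost.  A program is a finite text that does not depend on the
   dimensions or on the data.  Natural numbers, which serve as indices and loop
   bounds, only have addition and truncated subtraction, and there is no
   conversion between reals and naturals. *)

Inductive iexp : Type :=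
| Iconst of nat
| Iget of nat & iexp                (* array name, position *)
| Iadd of iexp & iexp
| Isub of iexp & iexp.

Inductive rexp : Type :=
| Rzero
| Rone
| Rget of nat & iexp & iexp         (* array name, row, column *)
| Radd of rexp & rexp
| Rsub of rexp & rexp
| Rmul of rexp & rexp
| Rdiv of rexp & rexp.              (* division by zero yields zero *)

Inductive test : Type :=
| Tile of iexp & iexp
| Trle of rexp & rexp
| Tnot of test
| Tand of test & test.

Inductive cmd : Type :=
| Skip
| Seq of cmd & cmd
| Iset of nat & iexp & iexp
| Rset of nat & iexp & iexp & rexp
| If of test & cmd & cmd
| For of nat & iexp & cmd.          (* counter, bound, body *)

Record mem (R : realType) := Mem {
  rmem : nat -> nat -> nat -> R;
  imem : nat -> nat -> nat
}.

Definition blank (R : realType) : mem R :=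
  Mem (fun _ _ _ => 0) (fun _ _ => 0%N).

Section Semantics.
Context {R : realType}.
Implicit Types (M : mem R).

Fixpoint ieval M (e : iexp) : nat :=
  match e with
  | Iconst k => k
  | Iget a e1 => imem M a (ieval M e1)
  | Iadd e1 e2 => (ieval M e1 + ieval M e2)%N
  | Isub e1 e2 => (ieval M e1 - ieval M e2)%N
  end.

Fixpoint reval M (e : rexp) : R :=
  match e with
  | Rzero => 0
  | Rone => 1
  | Rget a i j => rmem M a (ieval M i) (ieval M j)
  | Radd e1 e2 => reval M e1 + reval M e2
  | Rsub e1 e2 => reval M e1 - reval M e2
  | Rmul e1 e2 => reval M e1 * reval M e2
  | Rdiv e1 e2 => reval M e1 / reval M e2
  end.

Fixpoint teval M (t : test) : bool :=
  match t with
  | Tile e1 e2 => (ieval M e1 <= ieval M e2)%N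
  | Trle e1 e2 => reval M e1 <= reval M e2
  | Tnot t1 => ~~ teval M t1
  | Tand t1 t2 => teval M t1 && teval M t2
  end.

Definition iset M (a k v : nat) : mem R :=
  Mem (rmem M)
      (fun a' k' => if (a' == a) && (k' == k) then v else imem M a' k').

Definition rset M (a i j : nat) (v : R) : mem R :=
  Mem (fun a' i' j' =>
         if [&& a' == a, i' == i & j' == j] then v else rmem M a' i' j')
      (imem M).

End Semantics.

(* Every constant, memory access, operation and comparison, on reals as well as
   on naturals, costs one unit. *)
Fixpoint icost (e : iexp) : nat :=
  match e with
  | Iconst _ => 1
  | Iget _ e1 => (icost e1).+1
  | Iadd e1 e2 | Isub e1 e2 => (icost e1 + icost e2).+1
  end.

Fixpoint rcost (e : rexp) : nat :=
  match e with
  | Rzero | Rone => 1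
  | Rget _ i j => (icost i + icost j).+1
  | Radd e1 e2 | Rsub e1 e2 | Rmul e1 e2 | Rdiv e1 e2 =>
      (rcost e1 + rcost e2).+1
  end.

Fixpoint tcost (t : test) : nat :=
  match t with
  | Tile e1 e2 => (icost e1 + icost e2).+1
  | Trle e1 e2 => (rcost e1 + rcost e2).+1
  | Tnot t1 => (tcost t1).+1
  | Tand t1 t2 => (tcost t1 + tcost t2).+1
  end.

(* The final memory and the cost of the execution.  The bound of a loop is
   evaluated once; its counter is cell 0 of the natural number array [a]. *)
Fixpoint exec (R : realType) (p : cmd) (M : mem R) : mem R * nat :=
  match p with
  | Skip => (M, 1%N)
  | Seq p1 p2 =>
      let r1 := exec p1 M in
      let r2 := exec p2 r1.1 in
      (r2.1, (r1.2 + r2.2)%N)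
  | Iset a k e =>
      (iset M a (ieval M k) (ieval M e), (icost k + icost e).+1)
  | Rset a i j e =>
      (rset M a (ieval M i) (ieval M j) (reval M e),
       (icost i + icost j + rcost e).+1)
  | If t p1 p2 =>
      let r := exec (if teval M t then p1 else p2) M in
      (r.1, (tcost t + r.2).+1)
  | For a e p1 =>
      foldl (fun (acc : mem R * nat) (v : nat) =>
               let r := exec p1 (iset acc.1 a 0 v) in
               (r.1, (acc.2 + r.2).+1))
            (M, (icost e).+1) (iota 0 (ieval M e))
  end.

(** * Implementation of a pivot rule *)

Definition entry (R : realType) (p q : nat) (X : 'M[R]_(p, q)) (i j : nat) : R :=
  match (insub i : option 'I_p), (insub j : option 'I_q) with
  | Some i', Some j' => X i' j'
  | _, _ => 0
  end.

Definition onat (n : nat) (o : option 'I_n) : nat :=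
  if o is Some i then (nat_of_ord i).+1 else 0%N.

Section Implementation.
Context {R : realType} {m n : nat}.
Context {A : 'M[R]_(m, n)} {b : 'cV[R]_m} {c : 'cV[R]_n}.

(* Real arrays 0 to 3 hold [A], [b], [c], [y]; natural number array 0 holds [m]
   and [n], and array 1 the elements of [B].  All other cells keep what was
   stored at the previous iteration. *)
Definition load (B : basis A) (y : 'cV[R]_n) (M : mem R) : mem R :=
  Mem (fun a => match a with
                | 0 => entry A
                | 1 => entry b
                | 2 => entry c
                | 3 => entry y
                | _ => rmem M a
                end)
      (fun a => match a with
                | 0 => fun k => nth 0%N [:: m; n] k
                | 1 => fun k => if (insub k : option 'I_m) is Some k'
                                then nat_of_ord (bidx (bcard B) k') else 0%N
                | _ => imem M a
                end).

Definition iterate (code : cmd) (B : basis A) (y : 'cV[R]_n) (M : mem R) :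
  mem R * nat := exec code (load B y M).

(* [visit code y x B s M]: while the algorithm stays at [x], it is at the
   basis [B] with information [s], and [code], run at each of the previous
   iterations at [x] with the direction [y] and started from a blank memory on
   arrival at [x], has left the memory [M]. *)
Inductive visit (rule : pivot_rule A b c) (code : cmd) (y x : 'cV[R]_n) :
  basis A -> info rule -> mem R -> Prop :=
| visit_arrival B s : arrival B s -> bsol b B = x ->
    visit code y x B s (blank R)
| visit_stay B s M B' : visit code y x B s M ->
    simplex_step B s B' 0 ->
    visit code y x B' (update B s) (iterate code B y M).1.

(* The entering and the leaving index are read in cells 0 and 1 of the natural
   number array 2, shifted by one, zero standing for [None]. *)
Definition implements_at (rule : pivot_rule A b c) (code : cmd)
    (y x : 'cV[R]_n) (cost : nat) : Prop :=
  forall B (s : info rule) M, visit code y x B s M ->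
    let out := iterate code B y M in
    [/\ imem out.1 2 0 = onat (enter B s),
        imem out.1 2 1 = onat (leave B s) &
        (out.2 <= cost)%N].

End Implementation.

(* Main.v *)
Require Import Defs.
From mathcomp Require Import all_boot all_order all_algebra.
From mathcomp Require Import reals.
From mathcomp Require boolp classical_sets.
Set Implicit Arguments.
Unset Strict Implicit.
Unset Printing Implicit Defensive.
Import Order.TTheory GRing.Theory Num.Theory.
Local Open Scope ring_scope.

(** While the algorithm stays at a non-optimal vertex [x], the rule carries a
    vector [y] with [A y = 0], [c^T y < 0] and [y_j >= 0] wherever [x_j = 0]
    ([descent]); such a vector is a direction along which [x] can be improved.
    In the current basis, [c^T y] is the sum, over the non-basic indices, of
    reduced cost times entry of [y], and these entries are nonnegative.  Hence
    some non-basic [f] has a negative reduced cost and [y_f > 0]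
    ([exists_entering]), and the rule lets such an [f] enter.

    Adding to [y] a nonnegative multiple of the edge direction of [f] does not
    increase its cost, since the cost of that edge is the reduced cost of [f].
    If the pivot is degenerate, [y] is moved along the edge until the first
    entry in a candidate row of ratio zero vanishes, and that row is the one
    that leaves ([turn], [turn_descent]).  After the pivot the leaving index is
    non-basic with entry 0 in the new [y], the index [f] is basic, and the other
    non-basic entries have not changed: the number of positive non-basic entries
    of [y] has dropped.  It is at most [n - m], and it is positive as long as
    [y] improves [x], so at most [n - m - 1] degenerate pivots fit
    ([degenerate_pivots_nonbasic_support]).

    The program recomputes the inverse of the basis matrix at each iteration
    and then evaluates the definitions of the rule.  The inverse is built row by
    row by orthogonal projection ([partial_inverse_step]); every division there
    is by the squared length of a nonzero vector, so no search for a pivot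
    element is needed.  The program consists of loops of three shapes, for
    filling an array with sums ([fill_sumsP]), selecting an index
    ([scan_loopP]) and adding to the entries at given positions ([scatterP]).
    Its cost is read off its text: all loop bounds are 0, 1, [m] or [n], so the
    cost is at most the size of the text times [(n + m + 1)] to the power of the
    nesting depth of the loops ([exec_cost]). *)

(* [fraction] and [ssrbool] reuse these two names. *)
Local Notation memory := Defs.mem.
Local Notation ratio := Defs.ratio.

(** * Scanning for a least candidate *)

Section Scan.
Variables (p : nat) (d : Order.disp_t) (T : orderType d).
Variables (P : pred 'I_p) (key : 'I_p -> T).

(** The selection is a left fold so that it follows the loop of [scan_loop]
    step by step; ties go to the smallest index. *)
Definition scan_step (o : option 'I_p) (k : 'I_p) : option 'I_p :=
  if P k && (if o is Some l then ~~ (key l <= key k)%O else true)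
  then Some k else o.

Definition scan : option 'I_p := foldl scan_step None (enum 'I_p).

Lemma scanP :
  match scan with
  | Some l => P l /\ forall k, P k -> (key l <= key k)%O
  | None => forall k, ~~ P k
  end.
Proof.
suff: match scan with
  | Some l => P l /\ forall k, k \in enum 'I_p -> P k -> (key l <= key k)%O
  | None => forall k, k \in enum 'I_p -> ~~ P k
  end.
  case: scan => [l [Pl Hl]|H]; last by move=> k; apply: H; rewrite mem_enum.
  by split=> // k; apply: Hl; rewrite mem_enum.
rewrite /scan; elim/last_ind: (enum 'I_p) => [|s k] //=.
rewrite foldl_rcons; case: foldl => [l [Pl Hl]|H]; rewrite /scan_step /=.
  case: ifP => [/andP[Pk]|Hk].
    rewrite -ltNge => lt_kl; split=> // h; rewrite mem_rcons inE.
    case/predU1P=> [-> // | hs Ph].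
    exact: ltW (lt_le_trans lt_kl (Hl h hs Ph)).
  split=> // h; rewrite mem_rcons inE => /predU1P[-> Pk | ]; last exact: Hl.
  by move/negbT: Hk; rewrite Pk negbK.
rewrite andbT; case: ifP => [Pk | /negbT Pk].
  split=> // h; rewrite mem_rcons inE => /predU1P[-> // | hs].
  by rewrite (negPf (H h hs)).
by move=> h; rewrite mem_rcons inE => /predU1P[->|]; last exact: H.
Qed.

End Scan.

(** * Basic solutions and edge directions *)

Section Edges.
Context {R : realType} {m n : nat} {A : 'M[R]_(m, n)}.
Implicit Types (b : 'cV[R]_m) (c x y : 'cV[R]_n) (B : basis A) (f i j : 'I_n).

Definition Bidx B (k : 'I_m) : 'I_n := bidx (bcard B) k.

Lemma Bidx_inj B : injective (Bidx B).
Proof. by move=> k l /enum_val_inj /cast_ord_inj. Qed.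

Lemma Bidx_in B k : Bidx B k \in B.
Proof. exact: enum_valP. Qed.

Lemma Bidx_onto B j : j \in B -> exists k, j = Bidx B k.
Proof.
move=> jB; exists (cast_ord (bcard B) (enum_rank_in jB j)).
by rewrite /Bidx /bidx cast_ordK enum_rankK_in.
Qed.

Lemma padE B p (X : 'M[R]_(m, p)) j q :
  pad B X j q = \sum_k (Bidx B k == j)%:R * X k q.
Proof. by rewrite mxE; apply: eq_bigr => k _; rewrite !mxE. Qed.

Lemma pad_in B p (X : 'M[R]_(m, p)) k q : pad B X (Bidx B k) q = X k q.
Proof.
rewrite padE (bigD1 k) //= eqxx mul1r big1 ?addr0 // => l neq_lk.
by rewrite (inj_eq (@Bidx_inj B)) (negPf neq_lk) mul0r.
Qed.

Lemma pad_out B p (X : 'M[R]_(m, p)) j q : j \notin B -> pad B X j q = 0.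
Proof.
move=> jB; rewrite padE big1 // => k _; case: eqP => [jE|_]; last first.
  by rewrite mul0r.
by rewrite -jE Bidx_in in jB.
Qed.

Lemma mulmx_pad B p q (Y : 'M[R]_(q, n)) (X : 'M[R]_(m, p)) :
  Y *m pad B X = colsub (Bidx B) Y *m X.
Proof.
rewrite /pad mulmxA; congr (_ *m _); apply/matrixP => i k.
rewrite !mxE (bigD1 (Bidx B k)) //= !mxE eqxx mulr1 big1 ?addr0 // => j neq.
by rewrite !mxE [_ == j]eq_sym (negPf neq) mulr0.
Qed.

Lemma mulmx_Abar B : A *m Abar B = A.
Proof. by rewrite mulmx_pad mulmxA mulmxV ?mul1mx //; apply: bnonsing. Qed.

(** [Abar B] is [A] multiplied on the left by a matrix, so it kills what [A]
    kills. *)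
Lemma Abar_mulmx B p (X : 'M[R]_(n, p)) : A *m X = 0 -> Abar B *m X = 0.
Proof. by move=> AX0; rewrite /Abar /pad -!mulmxA AX0 !mulmx0. Qed.

Lemma Abar_basic B j k : Abar B j (Bidx B k) = (j == Bidx B k)%:R.
Proof.
have -> : Abar B j (Bidx B k) = pad B (1%:M : 'M_m) j k.
  rewrite !padE; apply: eq_bigr => l _; congr (_ * _).
  rewrite -(mulVmx (bnonsing B)).
  by rewrite !mxE; apply: eq_bigr => h _; rewrite !mxE.
have [jB|jB] := boolP (j \in B).
  by case/Bidx_onto: jB => l ->; rewrite pad_in mxE (inj_eq (@Bidx_inj B)).
by rewrite pad_out //; case: eqP jB => // ->; rewrite Bidx_in.
Qed.

(** The direction in which the basic solution moves when [f] enters: entry 1 at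
    [f], minus the column of [f] on the basis. *)
Definition edge B f : 'cV[R]_n := col f (1%:M - Abar B).

Lemma edgeE B f j : edge B f j 0 = (j == f)%:R - Abar B j f.
Proof. by rewrite !mxE. Qed.

Lemma mulmx_edge B f : A *m edge B f = 0.
Proof. by rewrite /edge colE mulmxA mulmxBr mulmx1 mulmx_Abar subrr mul0mx. Qed.

Lemma objective_edge B c f : objective c (edge B f) = redcost c B 0 f.
Proof.
by rewrite /objective /edge colE mulmxA -colE mxE mulmxBr mulmx1.
Qed.

Lemma redcost_basic B c f : f \in B -> redcost c B 0 f = 0.
Proof.
case/Bidx_onto=> k ->; rewrite -objective_edge /objective mxE big1 // => j _.
by rewrite edgeE Abar_basic subrr mulr0.
Qed.

Lemma objective_redcost B c y :
  A *m y = 0 -> objective c y = \sum_j redcost c B 0 j * y j 0.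
Proof.
move=> Ay0; have -> : objective c y = (redcost c B *m y) 0 0.
  by rewrite mulmxBl -mulmxA Abar_mulmx // mulmx0 subr0.
by rewrite mxE.
Qed.

Lemma mulmx_bsol b B : A *m bsol b B = b.
Proof. by rewrite mulmx_pad mulmxA mulmxV ?mul1mx //; apply: bnonsing. Qed.

Lemma bsol_unique b B x :
  A *m x = b -> (forall j, j \notin B -> x j 0 = 0) -> bsol b B = x.
Proof.
move=> Axb x0; have xE : x = pad B (rowsub (Bidx B) x).
  apply/colP=> j; have [/Bidx_onto[k ->]|jB] := boolP (j \in B).
    by rewrite pad_in mxE.
  by rewrite pad_out // x0.
rewrite /bsol -Axb [in A *m x]xE mulmx_pad.
by rewrite mulKmx -?xE //; apply: bnonsing.
Qed.

(** Otherwise every term in the expansion of [c^T y] by reduced costs would be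
    nonnegative. *)
Lemma exists_entering B c y :
  A *m y = 0 ->
  (forall j, j \notin B -> 0 <= y j 0) -> objective c y < 0 ->
  exists f, (redcost c B 0 f < 0) && (0 < y f 0).
Proof.
move=> Ay0 y_ge0; rewrite (objective_redcost B) // => lt0.
apply/existsP; apply: contraTT lt0; rewrite negb_exists -leNgt => /forallP H.
apply: sumr_ge0 => j _; have [jB|jB] := boolP (j \in B).
  by rewrite redcost_basic ?mul0r.
move: (H j) (y_ge0 j jB); rewrite negb_and -!leNgt => /orP[rc yj|yj0 yj].
  exact: mulr_ge0.
by have -> : y j 0 = 0; [apply/eqP; rewrite eq_le yj0 yj | rewrite mulr0].
Qed.

(** For a feasible [x] this is equivalent to [improving_direction], without the
    step length, and in boolean form. *)
Definition descent c x y : bool :=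
  [&& A *m y == 0, objective c y < 0 &
      [forall j, (x j 0 == 0) ==> (0 <= y j 0)]].

Lemma descentP c x y :
  reflect [/\ A *m y = 0, objective c y < 0 & forall j, x j 0 = 0 -> 0 <= y j 0]
          (descent c x y).
Proof.
apply: (iffP and3P) => -[/eqP ? ? H]; split=> //.
  by move=> j /eqP xj; apply: (implyP (forallP H j)).
by apply/forallP=> j; apply/implyP=> /eqP; apply: H.
Qed.

Lemma improving_descent c x y : improving_direction A c x y -> descent c x y.
Proof.
case=> Ay0 cy [e0 e0gt0 /(_ e0)]; rewrite e0gt0 lexx => /(_ isT) H.
apply/descentP; split=> // j xj; have := H j.
by rewrite !mxE xj add0r pmulr_rge0.
Qed.

Lemma nonoptimal_descent b c x :
  lp_feasible A b x -> ~ lp_optimal A b c x -> exists y, descent c x y.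
Proof.
move=> xP x_nopt; have [//|no] := boolp.pselect (exists y, descent c x y).
case: x_nopt; split=> // z [Az z_ge0]; rewrite leNgt; apply/negP=> lt_zx.
(* A better feasible point lies in an improving direction. *)
case: no; exists (z - x); apply/descentP; split.
- by rewrite mulmxBr Az (proj1 xP) subrr.
- suff -> : objective c (z - x) = objective c z - objective c x.
    by rewrite subr_lt0.
  by rewrite /objective mulmxBr !mxE.
- by move=> j xj; rewrite !mxE xj subr0; apply: z_ge0.
Qed.

End Edges.

Arguments descent {R m n} A c x y.

(** * The pivot rule and its degenerate pivots *)

Section Rule.
Context {R : realType} {m n : nat}.
Variables (A : 'M[R]_(m, n)) (b : 'cV[R]_m) (c : 'cV[R]_n).
Implicit Types (x y : 'cV[R]_n) (B : basis A) (f i j : 'I_n).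

(** With a constant key, the scan returns the first index that qualifies. *)
Definition entering y B : option 'I_n :=
  scan (fun f => (redcost c B 0 f < 0) && (0 < y f 0)) (fun=> 0 : R).

(** The second component breaks the ties of the ratio test.  When the minimum
    ratio is 0, it finds the entry of [y] that vanishes first when [y] is moved
    along the edge of [f]. *)
Definition leave_key y B f (k : 'I_m) : R *l R :=
  (ratio b B f (Bidx B k), y (Bidx B k) 0 / Abar B (Bidx B k) f).

Definition leaving y B f : option 'I_n :=
  omap (Bidx B) (scan (fun k => 0 < Abar B (Bidx B k) f) (leave_key y B f)).

(** A rule has to answer for every vector [y], so when [y] shows no entering
    index any negative reduced cost will do; this never happens if [y] improves
    the basic solution ([entering_descent]). *)
Definition enter_any y B : option 'I_n :=
  if entering y B is Some f then Some f else [pick f | redcost c B 0 f < 0].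

(** The multiple of the edge is the one that brings the entry of a basic index
    [i] to 0. *)
Definition turn y B f i : 'cV[R]_n := y + (y i 0 / Abar B i f) *: edge B f.

Lemma enteringP y B :
  match entering y B with
  | Some f => redcost c B 0 f < 0 /\ 0 < y f 0
  | None => forall f, ~~ ((redcost c B 0 f < 0) && (0 < y f 0))
  end.
Proof.
have := scanP (fun f => (redcost c B 0 f < 0) && (0 < y f 0)) (fun=> 0 : R).
by rewrite -/(entering y B); case: (entering y B) => // f [/andP[]].
Qed.

Lemma enter_anyP y B :
  match enter_any y B with
  | Some f => can_enter c B f
  | None => boptimal c B
  end.
Proof.
have enterI f : redcost c B 0 f < 0 -> can_enter c B f.
  move=> lt0; split=> //.
  by apply: contraTN lt0 => /redcost_basic ->; rewrite ltxx.
rewrite /enter_any; have := enteringP y B.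
case: (entering y B) => [f [+ _] | _]; first exact: enterI.
by case: pickP => [f | H f _]; [exact: enterI | rewrite leNgt H].
Qed.

Lemma leavingP y B f :
  match leaving y B f with
  | Some i => [/\ can_leave b B f i &
      forall j, j \in B -> 0 < Abar B j f -> ratio b B f j = ratio b B f i ->
        y i 0 / Abar B i f <= y j 0 / Abar B j f]
  | None => unbounded_column B f
  end.
Proof.
rewrite /leaving.
have := scanP (fun k => 0 < Abar B (Bidx B k) f) (leave_key y B f).
case: scan => [l [al Hl]|H] /=; last first.
  by move=> j /Bidx_onto[k ->]; apply/negP.
split; first split=> //; first exact: Bidx_in.
- move=> j /Bidx_onto[k ->] /Hl; rewrite /leave_key lexi_pair => /andP[] //.
- move=> j /Bidx_onto[k ->] /Hl; rewrite /leave_key lexi_pair => + E.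
  by rewrite E lexx.
Qed.

Lemma turnE y B f i j :
  turn y B f i j 0 = y j 0 + y i 0 / Abar B i f * ((j == f)%:R - Abar B j f).
Proof. by rewrite mxE [X in _ + X]mxE edgeE. Qed.

Lemma degenerate_leaving y B f i :
  leaving y B f = Some i -> ratio b B f i = 0 ->
  [/\ i \in B, 0 < Abar B i f & bsol b B i 0 = 0].
Proof.
have := leavingP y B f => + lE; rewrite lE => -[[iB aif _] _] /eqP.
by rewrite mulf_eq0 invr_eq0 [X in _ || X]gt_eqF // orbF => /eqP.
Qed.

(** The cost does not increase because the multiple of the edge is nonnegative.
    Only candidate rows [j] of ratio 0 could turn negative, and there
    [y_j / Abar j f] is at least the value at [i], by the tie-breaking. *)
Lemma turn_descent y B f i :
  descent A c (bsol b B) y -> redcost c B 0 f < 0 -> 0 < y f 0 ->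
  leaving y B f = Some i -> ratio b B f i = 0 ->
  descent A c (bsol b B) (turn y B f i).
Proof.
case/descentP=> Ay0 cy_lt0 y_ge0 rf yf lE r0.
have [iB aif xi] := degenerate_leaving lE r0.
have := leavingP y B f; rewrite lE => -[_ minP].
set al := y i 0 / Abar B i f in minP *.
have al_ge0 : 0 <= al by rewrite divr_ge0 ?y_ge0 ?(ltW aif).
apply/descentP; split=> [||j xj].
- by rewrite mulmxDr Ay0 add0r -scalemxAr mulmx_edge scaler0.
- apply: le_lt_trans cy_lt0.
  rewrite /objective mulmxDr -scalemxAr mxE [X in _ + X]mxE -/(objective c _).
  rewrite -/(objective c (edge B f)) objective_edge gerDl.
  by rewrite mulr_ge0_le0 // ltW.
rewrite turnE -/al; have yj := y_ge0 j xj.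
have [jB|jB] := boolP (j \in B); last first.
  by rewrite [Abar B j f]pad_out // subr0 addr_ge0 // mulr_ge0 // ler0n.
have -> : j == f = false.
  by apply: contraTF rf => /eqP <-; rewrite redcost_basic ?ltxx.
rewrite sub0r mulrN subr_ge0.
have [ajf|ajf] := ltP 0 (Abar B j f); last first.
  by apply: le_trans yj; rewrite mulr_ge0_le0.
rewrite -ler_pdivlMr //; apply: minP => //.
by rewrite r0 /ratio xj mul0r.
Qed.

(** The number of degenerate pivots is bounded even if [dir x] is no improving
    direction: another one, which exists when [x] is not optimal, is then
    chosen non-constructively. *)
Definition first_direction (dir : 'cV[R]_n -> 'cV[R]_n) x : 'cV[R]_n :=
  if descent A c x (dir x) then dir x
  else classical_sets.xget 0 (descent A c x).

Section WithDirections.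
Variable dir : 'cV[R]_n -> 'cV[R]_n.

(** The stored information is the turned direction; it is [None] right after
    arrival at the current basic solution. *)
Definition current B (s : option 'cV[R]_n) : 'cV[R]_n :=
  if s is Some y then y else first_direction dir (bsol b B).

Definition rule_enter B s := enter_any (current B s) B.
Definition rule_leave B s := obind (leaving (current B s) B) (rule_enter B s).
Definition rule_update B s : option 'cV[R]_n :=
  match rule_enter B s, rule_leave B s with
  | Some f, Some i =>
      if ratio b B f i == 0 then Some (turn (current B s) B f i) else None
  | _, _ => None
  end.

Lemma rule_enterP B s : bfeasible b B ->
  match rule_enter B s with
  | Some f => can_enter c B f
  | None => boptimal c B
  end.
Proof. by move=> _; apply: enter_anyP. Qed.

Lemma rule_leaveP B s f : bfeasible b B -> rule_enter B s = Some f ->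
  match rule_leave B s with
  | Some i => can_leave b B f i
  | None => unbounded_column B f
  end.
Proof.
rewrite /rule_leave => _ -> /=; have := leavingP (current B s) B f.
by case: leaving => [i []|].
Qed.

Definition turning_rule : pivot_rule A b c :=
  @PivotRule R m n A b c (option 'cV[R]_n) None rule_enter rule_leave
    rule_update rule_enterP rule_leaveP.

Lemma degenerate_bsol B (s : info turning_rule) B' :
  simplex_step B s B' 0 -> bsol b B' = bsol b B.
Proof.
case=> f [i [/= fE lE B'E /esym r0]].
have lE' : leaving (current B s) B f = Some i.
  by move: lE; rewrite /rule_leave fE.
have [iB aif xi] := degenerate_leaving lE' r0.
apply: bsol_unique; first exact: mulmx_bsol.
move=> j; rewrite B'E !inE !negb_or negb_and negbK => /andP[_].
by case/orP=> [/eqP-> //|jB]; apply: pad_out.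
Qed.

Lemma update_nondegenerate B (s : info turning_rule) B' r :
  simplex_step B s B' r -> r <> 0 -> update B s = None.
Proof.
by case=> f [i [/= fE lE _ ->]] /eqP/negPf r0; rewrite /rule_update fE lE r0.
Qed.

Lemma entering_descent B y :
  descent A c (bsol b B) y -> exists2 f, entering y B = Some f &
   redcost c B 0 f < 0 /\ 0 < y f 0.
Proof.
case/descentP=> Ay0 cy y_ge0.
have [f fP] : exists f, (redcost c B 0 f < 0) && (0 < y f 0).
  by apply: exists_entering => // j jB; apply: y_ge0; apply: pad_out.
have := enteringP y B; case: entering => [g gP|/(_ f)/negP//].
by exists g.
Qed.

(** When [current B s] improves the basic solution, the fallback of [enter_any]
    is not reached. *)
Lemma degenerate_step_descent B (s : info turning_rule) B' :
  descent A c (bsol b B) (current B s) -> simplex_step B s B' 0 ->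
  exists f i,
  [/\ entering (current B s) B = Some f, leaving (current B s) B f = Some i,
      ratio b B f i = 0, bset B' = f |: (bset B :\ i) &
      update B s = Some (turn (current B s) B f i)].
Proof.
move=> dB [f [i [/= fE lE B'E /esym r0]]].
have [g gE _] := entering_descent dB.
have fg : f = g by move: fE; rewrite /rule_enter /enter_any gE => -[].
rewrite -fg in gE.
exists f, i; split=> //; first by move: lE; rewrite /rule_leave fE.
by rewrite /rule_update fE lE r0 eqxx.
Qed.

Lemma degenerate_step_current B (s : info turning_rule) B' :
  descent A c (bsol b B) (current B s) -> simplex_step B s B' 0 ->
  descent A c (bsol b B') (current B' (update B s)).
Proof.
move=> dB st; rewrite (degenerate_bsol st).
have [f [i [fE lE r0 _ ->]]] := degenerate_step_descent dB st.
have := enteringP (current B s) B; rewrite fE => -[rf yf].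
exact: turn_descent.
Qed.

Lemma first_direction_descent x :
  lp_feasible A b x -> ~ lp_optimal A b c x ->
  descent A c x (first_direction dir x).
Proof.
move=> xP xN; rewrite /first_direction; case: ifP => // _.
exact: (@classical_sets.xgetPex _ 0 (descent A c x) (nonoptimal_descent xP xN)).
Qed.

(** A non-degenerate pivot discards the stored direction and a degenerate one
    turns it without moving the basic solution. *)
Lemma reachable_descent B (s : info turning_rule) :
  reachable B s ->
  lp_feasible A b (bsol b B) -> ~ lp_optimal A b c (bsol b B) ->
  descent A c (bsol b B) (current B s).
Proof.
elim=> [{}B _ | {}B {}s B' r _ IH st]; first exact: first_direction_descent.
case: (eqVneq r 0) => [r0 | r_neq0] xP xN.
  rewrite r0 in st; apply: degenerate_step_current => //.
  by apply: IH; rewrite -(degenerate_bsol st).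
rewrite (update_nondegenerate st); last exact/eqP.
exact: first_direction_descent.
Qed.

Definition nonbasic_support y B : nat :=
  #|[set j | (j \notin B) && (0 < y j 0)]|.

(** The inequality is strict because an improving direction always has a
    positive non-basic entry.  A degenerate pivot removes the entering index
    from the support and adds nothing to it. *)
Lemma degenerate_pivots_nonbasic_support B (s : info turning_rule) k :
  descent A c (bsol b B) (current B s) -> degenerate_pivots k B s ->
  (k < nonbasic_support (current B s) B)%N.
Proof.
move=> + dP; elim: dP => [{}B {}s|{}k {}B {}s B' st _ IH] dB.
  have [f fE [rf yf]] := entering_descent dB.
  apply/card_gt0P; exists f; rewrite inE yf andbT.
  by apply: contraTN rf => /redcost_basic ->; rewrite ltxx.
have dB' := degenerate_step_current dB st.
apply: leq_ltn_trans (IH dB') _; apply: proper_card.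
have [f [i [fE lE r0 B'E ->]]] := degenerate_step_descent dB st.
have := enteringP (current B s) B; rewrite fE => -[rf yf] /=.
have [iB aif xi] := degenerate_leaving lE r0.
have fB : f \notin B by apply: contraTN rf => /redcost_basic ->; rewrite ltxx.
apply/properP; split; last first.
  by exists f; rewrite !inE ?fB ?yf // B'E !inE eqxx.
apply/subsetP=> j; rewrite !inE B'E !inE negb_or negb_and negbK.
case/andP=> /andP[jf]; have [->{j jf} _|ji /= jB] := eqVneq j i.
  rewrite turnE; have -> : i == f = false by apply: contraNF fB => /eqP <-.
  by rewrite sub0r mulrN mulfVK ?subrr ?ltxx // gt_eqF.
by rewrite jB turnE (negPf jf) [Abar B j f]pad_out // subrr mulr0 addr0.
Qed.

Lemma nonbasic_support_le y B : (nonbasic_support y B <= n - m)%N.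
Proof.
apply: (@leq_trans #|~: bset B|); last by rewrite cardsCs setCK card_ord bcard.
by apply: subset_leq_card; apply/subsetP => j; rewrite !inE => /andP[].
Qed.

End WithDirections.

End Rule.

(** * Inverting a matrix row by row *)

Section Inversion.
Variables (R : realFieldType) (m : nat) (M : 'M[R]_m).
Implicit Types (V : 'M[R]_m) (k : 'I_m).

(** Row [k] of [M], as a column, minus its orthogonal projection onto the span
    of the previous rows when [V] is a [partial_inverse] of order [k]: then
    [V M] is this projection. *)
Definition residue V k : 'cV[R]_m := (row k M)^T - V *m (M *m (row k M)^T).

(** A multiple of the residue is added to each column, so that row [k] of the
    product with [M] becomes right; the residue is orthogonal to the previous
    rows, whose products do not change. *)
Definition extend_inverse V k : 'M[R]_m :=
  V + ((row k M *m residue V k) 0 0)^-1 *: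
      (residue V k *m (delta_mx 0 k - row k M *m V)).

(** The symmetry of [V M], together with the other two conditions, makes it the
    orthogonal projection onto the span of the first [k] rows. *)
Definition partial_inverse (k : nat) V : Prop :=
  [/\ (V *m M)^T = V *m M,
      forall i j : 'I_m, (k <= j)%N -> V i j = 0 &
      forall j : 'I_m, (j < k)%N -> row j M *m V = delta_mx 0 j].

Lemma partial_inverse0 : partial_inverse 0 0.
Proof. by split=> [|i j _|j //]; rewrite ?mul0mx ?trmx0 ?mxE. Qed.

(** [V] only involves the first [k] columns, and on the corresponding rows
    [M V] agrees with the identity. *)
Lemma partial_inverse_idem k V : partial_inverse k V -> V *m (M *m V) = V.
Proof.
case=> _ V0 MV; rewrite -[RHS]mulmx1; apply/matrixP => i l.
rewrite [LHS]mxE [RHS]mxE; apply: eq_bigr => j _.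
have [lt_jk | /V0->] := ltnP j k; last by rewrite !mul0r.
congr (_ * _); move/rowP/(_ l): (MV j lt_jk).
by rewrite -row_mul !mxE eqxx /= eq_sym => ->.
Qed.

Hypothesis unitM : M \in unitmx.

(** As [1 - V M] is an orthogonal projection, this is the squared length of the
    residue.  It vanishes only if row [k] depends on the previous rows, which
    contradicts the invertibility of [M]. *)
Lemma row_residue_gt0 V k :
  partial_inverse k V -> 0 < (row k M *m residue V k) 0 0.
Proof.
move=> VP; have VMV := partial_inverse_idem VP; case: VP => VMsym V0 MV.
set a := row k M; set H := 1%:M - V *m M.
have pE : residue V k = H *m a^T by rewrite /residue mulmxBl mul1mx mulmxA.
have Hsym : H^T = H by rewrite linearB /= trmx1 VMsym.
have HH : H *m H = H.
  have VMVM : V *m M *m (V *m M) = V *m M by rewrite mulmxA -(mulmxA V) VMV.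
  by rewrite /H mulmxBr mulmx1 mulmxBl mul1mx VMVM subrr subr0.
have -> : (a *m residue V k) 0 0 = \sum_j (residue V k j 0) ^+ 2.
  have -> : a *m residue V k = (residue V k)^T *m residue V k.
    by rewrite pE trmx_mul trmxK Hsym -!mulmxA (mulmxA H H) HH.
  by rewrite mxE; apply: eq_bigr => j _; rewrite mxE.
rewrite lt_def sumr_ge0 ?andbT => [|j _]; last exact: sqr_ge0.
apply/eqP => /psumr_eq0P p0.
have {}p0 : residue V k = 0.
  apply/colP=> j; rewrite [RHS]mxE; apply/eqP.
  by rewrite -sqrf_eq0 p0 // => l _; apply: sqr_ge0.
have aE : a = a *m V *m M.
  have : (residue V k)^T = 0 by rewrite p0 trmx0.
  rewrite pE trmx_mul trmxK Hsym mulmxBr mulmx1 mulmxA => /eqP.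
  by rewrite subr_eq0 => /eqP.
have : delta_mx 0 k = a *m V.
  by rewrite -[LHS](mulmxK unitM) -rowE -/a {1}aE mulmxK.
move/rowP/(_ k); rewrite mxE !eqxx mxE big1 => [/eqP|j _].
  by rewrite oner_eq0.
by rewrite V0 // mulr0.
Qed.

Lemma partial_inverse_step V k :
  partial_inverse k V -> partial_inverse k.+1 (extend_inverse V k).
Proof.
move=> VP; have := row_residue_gt0 VP; have VMV := partial_inverse_idem VP.
case: VP => VMsym V0 MV; rewrite /extend_inverse.
set p := residue V k; set a := row k M; set d := (a *m p) 0 0 => d_gt0.
have apE : a *m p = d%:M by rewrite [LHS]mx11_scalar.
have pT : p^T = a - a *m V *m M.
  by rewrite /p /residue linearB /= trmxK mulmxA trmx_mul VMsym trmxK mulmxA.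
split=> [|i j lt_kj|j].
- rewrite mulmxDl -scalemxAl -mulmxA (mulmxBl (delta_mx 0 k)) -rowE -/a -pT.
  by rewrite linearD linearZ /= VMsym trmx_mul trmxK.
- have qj : (delta_mx 0 k - a *m V) 0 j = 0.
    rewrite mxE [X in _ + X]mxE !mxE eqxx gt_eqF // big1 ?subrr // => l _.
    by rewrite V0 ?mulr0 1?ltnW.
  by rewrite mxE V0 1?ltnW // add0r mxE mxE big_ord1 qj !mulr0.
rewrite ltnS leq_eqVlt => /predU1P[/ord_inj ->|lt_jk].
  rewrite -/a mulmxDr -scalemxAr mulmxA apE mul_scalar_mx scalerA.
  by rewrite mulVf ?gt_eqF // scale1r addrC subrK.
rewrite mulmxDr MV // -scalemxAr mulmxA.
suff -> : row j M *m p = 0 by rewrite mul0mx scaler0 addr0.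
by rewrite /p /residue mulmxBr (mulmxA _ V) MV // mulmxA -rowE subrr.
Qed.

Lemma partial_inverse_full V : partial_inverse m V -> V = invmx M.
Proof.
case=> _ _ MV; rewrite -[LHS](mulKmx unitM).
suff -> : M *m V = 1%:M by rewrite mulmx1.
by apply/row_matrixP=> j; rewrite row_mul MV // rowE mulmx1.
Qed.

End Inversion.

(** * Static analysis and loops of arithmetic programs *)

Fixpoint rwrites (p : cmd) : seq nat :=
  match p with
  | Skip | Iset _ _ _ => [::]
  | Rset a _ _ _ => [:: a]
  | Seq p1 p2 | If _ p1 p2 => rwrites p1 ++ rwrites p2
  | For _ _ p1 => rwrites p1
  end.

Fixpoint iwrites (p : cmd) : seq nat :=
  match p with
  | Skip | Rset _ _ _ _ => [::]
  | Iset a _ _ => [:: a]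
  | Seq p1 p2 | If _ p1 p2 => iwrites p1 ++ iwrites p2
  | For a _ p1 => a :: iwrites p1
  end.

Fixpoint rreads (e : rexp) : seq nat :=
  match e with
  | Rzero | Rone => [::]
  | Rget a _ _ => [:: a]
  | Radd e1 e2 | Rsub e1 e2 | Rmul e1 e2 | Rdiv e1 e2 => rreads e1 ++ rreads e2
  end.

(** Bounds that are 0, 1 or a cell of array 0, where [m] and [n] are kept. *)
Definition is_bound (e : iexp) : bool :=
  match e with
  | Iconst k => (k <= 1)%N
  | Iget 0 (Iconst _) => true
  | _ => false
  end.

Fixpoint loops_bounded (p : cmd) : bool :=
  match p with
  | Skip | Rset _ _ _ _ | Iset _ _ _ => true
  | Seq p1 p2 | If _ p1 p2 => loops_bounded p1 && loops_bounded p2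
  | For _ e p1 => is_bound e && loops_bounded p1
  end.

(** The cost when each loop body runs once, counting both branches of each
    test. *)
Fixpoint text_size (p : cmd) : nat :=
  match p with
  | Skip => 1
  | Seq p1 p2 => (text_size p1 + text_size p2)%N
  | Iset a k e => (icost k + icost e).+1%N
  | Rset a i j e => (icost i + icost j + rcost e).+1%N
  | If t p1 p2 => (tcost t + (text_size p1 + text_size p2)).+1%N
  | For a e p1 => ((icost e).+1 + (text_size p1).+1)%N
  end.

Fixpoint loop_depth (p : cmd) : nat :=
  match p with
  | Skip | Rset _ _ _ _ | Iset _ _ _ => 0
  | Seq p1 p2 | If _ p1 p2 => maxn (loop_depth p1) (loop_depth p2)
  | For _ _ p1 => (loop_depth p1).+1
  end.

Local Notation ctr a := (Iget a (Iconst 0)).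
Local Notation row_ctr := (ctr 10).
Local Notation col_ctr := (ctr 11).
Local Notation sum_ctr := (ctr 12).

(** [X i j := E0 + \sum_l E] over the three ranges.  The third counter is reset
    before [E0] is evaluated, which gives [E0] a determined value even if it
    reads this counter. *)
Definition fill_sums (X : nat) (e1 e2 e3 : iexp) (E0 E : rexp) : cmd :=
  For 10 e1 (For 11 e2 (Seq (Iset 12 (Iconst 0) (Iconst 0))
    (Seq (Rset X row_ctr col_ctr E0)
      (For 12 e3 (Rset X row_ctr col_ctr (Radd (Rget X row_ctr col_ctr) E)))))).

(** Cell 0 of array [w] holds the index selected so far plus one, and 0 if there
    is none.  [T] tests whether the current index is a candidate and [L] whether
    the key of the selected index is at most the key of the current one. *)
Definition scan_loop (w : nat) (e : iexp) (T L : test) : cmd :=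
  Seq (Iset w (Iconst 0) (Iconst 0))
    (For 10 e
      (If (Tand T (Tnot (Tand (Tnot (Tile (ctr w) (Iconst 0))) L)))
        (Iset w (Iconst 0) (Iadd row_ctr (Iconst 1))) Skip)).

Definition scatter (X : nat) (e pos : iexp) (E : rexp) : cmd :=
  For 10 e (Rset X pos (Iconst 0) (Radd (Rget X pos (Iconst 0)) E)).

Section Machine.
Variable R : realType.
Implicit Types (M : memory R) (p : cmd) (e : iexp) (E : rexp) (a : nat).

Lemma exec_Seq p1 p2 M : (exec (Seq p1 p2) M).1 = (exec p2 (exec p1 M).1).1.
Proof. by []. Qed.

Lemma exec_For a e p M :
  (exec (For a e p) M).1 =
  foldl (fun M' v => (exec p (iset M' a 0 v)).1) M (iota 0 (ieval M e)).
Proof.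
rewrite /=; move: (iota _ _) (icost e).+1 => s.
by elim: s M => //= v s IH M k; apply: IH.
Qed.

Lemma exec_For_ind (I : nat -> memory R -> Prop) a e p M :
  I 0 M ->
  (forall v M', (v < ieval M e)%N -> I v M' ->
     I v.+1 (exec p (iset M' a 0 v)).1) ->
  I (ieval M e) (exec (For a e p) M).1.
Proof.
rewrite exec_For => I0 IS; move: (ieval M e) IS => N IS.
suff H v : (v <= N)%N ->
    I v (foldl (fun M' v => (exec p (iset M' a 0 v)).1) M (iota 0 v)).
  exact: H.
elim: v => // v IH lt_vN; rewrite -addn1 iotaD add0n foldl_cat /= addn1.
by apply: IS => //; apply: IH; apply: ltnW.
Qed.

Lemma exec_rframe p M a i j :
  a \notin rwrites p -> rmem (exec p M).1 a i j = rmem M a i j.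
Proof.
elim: p M => [|p1 IH1 p2 IH2|b k e|b k l e|t p1 IH1 p2 IH2|b e p IH] M //=.
- by rewrite mem_cat negb_or => /andP[? ?]; rewrite IH2 ?IH1.
- by rewrite inE => /negPf ->.
- by rewrite mem_cat negb_or => /andP[? ?]; case: ifP => _; rewrite ?IH2 ?IH1.
move=> aP; rewrite -/(exec (For b e p) M).
pose same (_ : nat) M' := rmem M' a i j = rmem M a i j.
apply: (exec_For_ind (I := same)) => //= v M' _; rewrite /same => <-.
exact: IH.
Qed.

Lemma exec_iframe p M a k :
  a \notin iwrites p -> imem (exec p M).1 a k = imem M a k.
Proof.
elim: p M => [|p1 IH1 p2 IH2|b l e|b h l e|t p1 IH1 p2 IH2|b e p IH] M //=.
- by rewrite mem_cat negb_or => /andP[? ?]; rewrite IH2 ?IH1.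
- by rewrite inE => /negPf ->.
- by rewrite mem_cat negb_or => /andP[? ?]; case: ifP => _; rewrite ?IH2 ?IH1.
rewrite inE negb_or => /andP[/negPf ab aP]; rewrite -/(exec (For b e p) M).
pose same (_ : nat) M' := imem M' a k = imem M a k.
apply: (exec_For_ind (I := same)) => //= v M' _; rewrite /same => <-.
by rewrite IH //= ab.
Qed.

(** Loop bounds that come from array 0 stay at most [N] as long as the program
    does not write to this array; each level of nesting then costs one factor
    [N]. *)
Lemma exec_cost N p M :
  (0 < N)%N -> loops_bounded p -> 0%N \notin iwrites p ->
  (forall k, (imem M 0 k <= N)%N) ->
  ((exec p M).2 <= text_size p * N ^ loop_depth p)%N.
Proof.
move=> N_gt0.
have powS d1 d2 : (d1 <= d2)%N -> (N ^ d1 <= N ^ d2)%N by apply: leq_pexp2l.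
have powM s d1 d2 : (d1 <= d2)%N -> (s * N ^ d1 <= s * N ^ d2)%N.
  by move=> le_d; rewrite leq_mul2l powS ?orbT.
have pow1 s d : (s <= s * N ^ d)%N by rewrite leq_pmulr ?expn_gt0 ?N_gt0.
elim: p M => [|p1 IH1 p2 IH2|b l e|b h l e|t p1 IH1 p2 IH2|b e p IH] M.
- by [].
- move=> /= /andP[b1 b2]; rewrite mem_cat negb_or => /andP[w1 w2] M0.
  rewrite mulnDl leq_add //.
    by apply: leq_trans (IH1 _ b1 w1 M0) _; rewrite powM ?leq_maxl.
  apply: leq_trans (IH2 _ b2 w2 _) _; last by rewrite powM ?leq_maxr.
  by move=> k; rewrite exec_iframe.
- by move=> _ _ _; apply: pow1.
- by move=> _ _ _; apply: pow1.
- move=> /= /andP[b1 b2]; rewrite mem_cat negb_or => /andP[w1 w2] M0.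
  rewrite -!addSn mulnDl leq_add ?pow1 // mulnDl; case: ifP => _.
    apply: leq_trans (IH1 _ b1 w1 M0) (leq_trans (powM _ _ _ (leq_maxl _ _)) _).
    exact: leq_addr.
  apply: leq_trans (IH2 _ b2 w2 M0) (leq_trans (powM _ _ _ (leq_maxr _ _)) _).
  exact: leq_addl.
case/andP=> be bp; rewrite inE negb_or => /andP[b0 wp] M0.
have le_eN : (ieval M e <= N)%N.
  case: e be => [k|a e|//|//] /=; first by move/leq_trans->.
  by case: a e => [|//] [].
set c := (text_size p * N ^ loop_depth p)%N in IH *.
have : ((exec (For b e p) M).2 <= (icost e).+1 + ieval M e * c.+1)%N.
  rewrite /=; have: forall M' k, (forall k, (imem M' 0 k <= N)%N) ->
    ((foldl (fun (acc : memory R * nat) (v : nat) =>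
               let r := exec p (iset acc.1 b 0 v) in
               (r.1, (acc.2 + r.2).+1)) (M', k) (iota 0 (ieval M e))).2
     <= k + size (iota 0 (ieval M e)) * c.+1)%N.
    elim: (iota 0 _) => [|v s IHs] M' k M'0 /=; first by rewrite addn0.
    apply: leq_trans (IHs _ _ _) _ => [k'|].
      by rewrite exec_iframe //= (negPf b0) M'0.
    rewrite mulSn addnA leq_add2r -addnS leq_add2l ltnS IH //.
    by move=> k'; rewrite /= (negPf b0) M'0.
  by rewrite size_iota; apply.
move/leq_trans; apply; rewrite /= mulnDl leq_add ?pow1 //.
apply: (@leq_trans (N * c.+1)%N); first by rewrite leq_mul2r le_eN orbT.
rewrite expnS mulnS mulSn; apply: leq_add; first exact: pow1.
by rewrite /c mulnCA.
Qed.

Lemma ieval_agree M M' e :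
  (forall a k, imem M' a k = imem M a k) -> ieval M' e = ieval M e.
Proof.
by move=> H; elim: e => //= [a e -> | e1 -> e2 -> | e1 -> e2 ->] //.
Qed.

Lemma reval_agree M M' E :
  (forall a k, imem M' a k = imem M a k) ->
  (forall a i j, a \in rreads E -> rmem M' a i j = rmem M a i j) ->
  reval M' E = reval M E.
Proof.
move=> Hi; elim: E => //= [a e1 e2 H|E1 IH1 E2 IH2 H|E1 IH1 E2 IH2 H|
  E1 IH1 E2 IH2 H|E1 IH1 E2 IH2 H].
- by rewrite H ?inE // !(ieval_agree _ Hi).
all: by rewrite IH1 ?IH2 // => a i j aE; apply: H; rewrite mem_cat aE ?orbT.
Qed.

Lemma teval_agree M M' (t : test) :
  (forall a k, imem M' a k = imem M a k) ->
  (forall a i j, rmem M' a i j = rmem M a i j) ->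
  teval M' t = teval M t.
Proof.
move=> Hi Hr; elim: t => [e1 e2|E1 E2|t IH|t1 IH1 t2 IH2] /=.
- by rewrite !(ieval_agree _ Hi).
- by rewrite !(@reval_agree M M').
- by rewrite IH.
- by rewrite IH1 IH2.
Qed.

(** [at1] and [at3] are the memories in which the bodies of the loops evaluate
    their expressions, as far as the counters are concerned. *)
Definition at1 M i := iset M 10 0 i.
Definition at3 M i j l := iset (iset (iset M 10 0 i) 11 0 j) 12 0 l.

(** During [fill_sums] and [scatter], everything but the target array [X] is
    known from the memory at the start and the counters. *)
Definition similar X M M' : Prop :=
  (forall a k, imem M' a k = imem M a k) /\
  (forall a i j, a != X -> rmem M' a i j = rmem M a i j).

Lemma is_bound_similar X M M' e i j l :
  is_bound e -> similar X (at3 M i j l) M' -> ieval M' e = ieval M e.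
Proof.
case: e => [|a e|//|//] //=.
by case: a e => [|//] [] //= k _ [-> _].
Qed.

Lemma similar_eval X M M' E :
  X \notin rreads E -> similar X M M' -> reval M' E = reval M E.
Proof.
move=> XE [Hi Hr]; apply: reval_agree => // a i j aE; apply: Hr.
by apply: contraNneq XE => <-.
Qed.

Lemma fill_sumsP X e1 e2 e3 E0 E M :
  is_bound e1 -> is_bound e2 -> is_bound e3 ->
  X \notin rreads E0 -> X \notin rreads E ->
  forall i j, (i < ieval M e1)%N -> (j < ieval M e2)%N ->
  rmem (exec (fill_sums X e1 e2 e3 E0 E) M).1 X i j =
  reval (at3 M i j 0) E0 + \sum_(0 <= l < ieval M e3) reval (at3 M i j l) E.
Proof.
move=> b1 b2 b3 XE0 XE.
set val := fun i j v =>
  reval (at3 M i j 0) E0 + \sum_(0 <= l < v) reval (at3 M i j l) E.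
have set1 a i j l v M' : similar X (at3 M i j l) M' ->
    similar X (iset (at3 M i j l) a 0 v) (iset M' a 0 v).
  by case=> Hi Hr; split=> // b k /=; rewrite Hi.
have near1 i j l i' M' : similar X (at3 M i j l) M' ->
    similar X (at3 M i' j l) (iset M' 10 0 i').
  move/(set1 10 _ _ _ i') => [Hi Hr]; split=> // a k; rewrite Hi /=.
  by case: (k == 0%N); do 3!case: eqP => [->|_] //=.
have near2 i j l j' M' : similar X (at3 M i j l) M' ->
    similar X (at3 M i j' l) (iset M' 11 0 j').
  move/(set1 11 _ _ _ j') => [Hi Hr]; split=> // a k; rewrite Hi /=.
  by case: (k == 0%N); do 3!case: eqP => [->|_] //=.
have near3 i j l l' M' : similar X (at3 M i j l) M' ->
    similar X (at3 M i j l') (iset M' 12 0 l').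
  move/(set1 12 _ _ _ l') => [Hi Hr]; split=> // a k; rewrite Hi /=.
  by case: (k == 0%N); do 3!case: eqP => [->|_] //=.
have rset1 i j l v M' : similar X (at3 M i j l) M' ->
    similar X (at3 M i j l) (rset M' X i j v).
  by case=> Hi Hr; split=> // a h k aX /=; rewrite (negPf aX) Hr.
(* Filling one cell leaves the other cells of [X] alone. *)
have cell i j l M' : similar X (at3 M i j l) M' ->
  let M2 := (exec (Seq (Iset 12 (Iconst 0) (Iconst 0))
    (Seq (Rset X row_ctr col_ctr E0)
      (For 12 e3 (Rset X row_ctr col_ctr (Radd (Rget X row_ctr col_ctr) E)))))
      M').1 in
  [/\ exists l', similar X (at3 M i j l') M2,
      rmem M2 X i j = val i j (ieval M e3) &
      forall i' j', (i' != i) || (j' != j) ->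
        rmem M2 X i' j' = rmem M' X i' j'].
  move=> /(near3 _ _ _ 0%N) S0 M2; rewrite /M2 exec_Seq exec_Seq.
  set M1 := (exec (Rset _ _ _ _) _).1.
  have cri l1 M'' : similar X (at3 M i j l1) M'' ->
      imem M'' 10 0 = i /\ imem M'' 11 0 = j.
    by case=> Hi _; rewrite !Hi.
  have [ri rj] := cri _ _ S0.
  have M1E : M1 = rset (iset M' 12 0 0) X i j (reval (at3 M i j 0) E0).
    by rewrite /M1 /= -(similar_eval XE0 S0) -[in RHS]ri -[in RHS]rj.
  have S1 : similar X (at3 M i j 0) M1 by rewrite M1E; apply: rset1.
  rewrite -(is_bound_similar b3 S1).
  apply: (@exec_For_ind (fun v M3 =>
    [/\ exists l', similar X (at3 M i j l') M3, rmem M3 X i j = val i j v &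
      forall i' j', (i' != i) || (j' != j) ->
        rmem M3 X i' j' = rmem M' X i' j'])).
    split; first by exists 0%N.
      by rewrite M1E /= !eqxx /val big_nil addr0.
    by move=> i' j'; rewrite M1E /= eqxx -negb_and => /negPf ->.
  move=> v M3 _ [[l' S3] V3 O3] /=.
  have S4 := near3 _ _ _ v _ S3; have [ri' rj'] := cri _ _ S4.
  rewrite /= in ri' rj'; rewrite ri' rj' (similar_eval XE S4).
  split; first by exists v; apply: rset1.
    by rewrite /= !eqxx /= V3 /val big_nat_recr //= addrA.
  move=> i' j' neq /=; move: (neq); rewrite eqxx -negb_and => /negPf ->.
  exact: O3.
have init : exists i j l, similar X (at3 M i j l) M.
  exists (imem M 10 0), (imem M 11 0), (imem M 12 0); split=> // a k /=.
  by case: (k =P 0%N) => [->|_]; do 3!case: eqP => [->|_] //=.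
pose rows v M' := (exists i j l, similar X (at3 M i j l) M') /\
  forall i j, (i < v)%N -> (j < ieval M e2)%N ->
    rmem M' X i j = val i j (ieval M e3).
suff [_ H] : rows (ieval M e1) (exec (fill_sums X e1 e2 e3 E0 E) M).1.
  by move=> i j; apply: H.
apply: (exec_For_ind (I := rows)) => [|v M1 _ [[i [j [l S1]]] V1]].
  by split.
have {}S1 := near1 _ _ _ v _ S1.
pose cols u M' := (exists j l, similar X (at3 M v j l) M') /\
  forall i j, (i < v.+1)%N -> (j < ieval M e2)%N ->
    (i < v)%N || (j < u)%N -> rmem M' X i j = val i j (ieval M e3).
set body := For 11 e2 _.
suff [[j1 [l1 S2]] V2] : cols (ieval M e2) (exec body (iset M1 10 0 v)).1.
  split; first by exists v, j1, l1.
  by move=> i' j' lt_i lt_j; rewrite V2 // lt_j orbT.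
rewrite -(is_bound_similar b2 S1).
apply: (exec_For_ind (I := cols)) => [|u M2 _ [[j1 [l1 S2]] V2]].
  split; first by exists j, l.
  by move=> i' j' _ lt_j; rewrite orbF => lt_i; apply: V1.
have {}S2 := near2 _ _ _ u _ S2.
have [[l3 S3] V3 O3] := cell _ _ _ _ S2.
split; first by exists u, l3.
move=> i' j' lt_i lt_j lt_ij.
have [/andP[/eqP-> /eqP->] //|neq] := boolP ((i' == v) && (j' == u)).
rewrite O3 -?negb_and //; apply: V2 => //.
case/orP: lt_ij => [-> //|]; rewrite ltnS leq_eqVlt.
case/predU1P=> [jE|->]; last by rewrite orbT.
move: neq lt_i; rewrite jE eqxx andbT ltnS leq_eqVlt.
by move=> /negPf -> /= ->.
Qed.

Lemma exec_If (t : test) p1 p2 M :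
  (exec (If t p1 p2) M).1 = (exec (if teval M t then p1 else p2) M).1.
Proof. by []. Qed.

(** The loop of [scan_loop] and the fold of [scan] are compared state by
    state. *)
Lemma foldl_rel (S1 S2 I : Type) (rel12 : S1 -> S2 -> Prop) f1 f2 (s : seq I) :
  (forall x1 x2 i, rel12 x1 x2 -> rel12 (f1 x1 i) (f2 x2 i)) ->
  forall x1 x2, rel12 x1 x2 -> rel12 (foldl f1 x1 s) (foldl f2 x2 s).
Proof. by move=> step; elim: s => //= i s IH x1 x2 /(step _ _ i)/IH. Qed.

Lemma foldl_map (S I J : Type) (f : S -> J -> S) (h : I -> J) x (s : seq I) :
  foldl f x (map h s) = foldl (fun y i => f y (h i)) x s.
Proof. by elim: s x => //= i s IH x; apply: IH. Qed.

Lemma scan_loopP w e (T L : test) M (p : nat) (d : Order.disp_t)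
    (K : orderType d) (P : pred 'I_p) (key : 'I_p -> K) :
  (w != 10)%N -> w != 0%N -> is_bound e -> ieval M e = p ->
  (forall o (k : 'I_p), teval (at1 (iset M w 0 o) k) T = P k) ->
  (forall k l : 'I_p,
     teval (at1 (iset M w 0 l.+1) k) L = (key l <= key k)%O) ->
  imem (exec (scan_loop w e T L) M).1 w 0 = onat (scan P key).
Proof.
move=> w10 w0 be eM TP LP; rewrite /scan_loop exec_Seq exec_For.
have -> : ieval (exec (Iset w (Iconst 0) (Iconst 0)) M).1 e = p.
  rewrite -eM; case: e be {eM} => [|a e|//|//] //=.
  by case: a e => [|//] [] //= k _; rewrite eq_sym (negPf w0).
pose good M' (o : option 'I_p) :=
  (forall a k, imem M' a k =
     imem (at1 (iset M w 0 (onat o)) (imem M' 10 0)) a k) /\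
  (forall a i j, rmem M' a i j = rmem M a i j).
rewrite -val_enum_ord foldl_map /scan.
suff : good (foldl (fun M' (k : 'I_p) => (exec (If (Tand T (Tnot (Tand
    (Tnot (Tile (ctr w) (Iconst 0))) L))) (Iset w (Iconst 0)
    (Iadd row_ctr (Iconst 1))) Skip) (iset M' 10 0 k)).1)
    (exec (Iset w (Iconst 0) (Iconst 0)) M).1 (enum 'I_p))
  (foldl (scan_step P key) None (enum 'I_p)).
  by case=> -> _; rewrite /at1 /= (negPf w10) !eqxx.
apply: foldl_rel => [M' o k [Hi Hr]|]; last first.
  split=> // a k; rewrite /at1 /=.
  case: (k =P 0%N) => [->|_]; last by rewrite !andbF.
  by case: (a =P 10%N) => [->|_] //=; rewrite ?andbT.
have sim a h :
    imem (iset M' 10 0 k) a h = imem (at1 (iset M w 0 (onat o)) k) a h.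
  rewrite /at1 /= Hi /at1 /=; by case: ((a == 10%N) && _).
have wE : imem M' w 0 = onat o by rewrite Hi /at1 /= (negPf w10) !eqxx.
have testE : teval (iset M' 10 0 k) (Tand T (Tnot (Tand
    (Tnot (Tile (ctr w) (Iconst 0))) L))) =
    P k && (if o is Some l then ~~ (key l <= key k)%O else true).
  rewrite /= (negPf w10) wE (teval_agree T sim Hr) TP.
  case: o wE sim {Hi} => [l|] wE sim //.
  by rewrite (teval_agree L sim Hr) LP.
rewrite exec_If testE /scan_step; case: (P k && _); last first.
  by split=> // a h; rewrite sim /at1 /=.
split=> // a h; rewrite /= addn1.
have := sim a h; rewrite /at1 /= => ->.
case: (h =P 0%N) => [->|_]; rewrite ?andbF ?andbT //=.
by case: (a =P 10%N) => [->|_] //=; case: eqP.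
Qed.

Lemma scatterP X e pos E M j :
  X \notin rreads E ->
  rmem (exec (scatter X e pos E) M).1 X j 0 =
  rmem M X j 0 + \sum_(0 <= i < ieval M e)
    (if ieval (at1 M i) pos == j then reval (at1 M i) E else 0).
Proof.
move=> XE.
pose good v M' :=
  (forall a k, imem (iset M' 10 0 0) a k = imem (iset M 10 0 0) a k) /\
  (forall a i j, a != X -> rmem M' a i j = rmem M a i j) /\ forall j,
  rmem M' X j 0 = rmem M X j 0 + \sum_(0 <= i < v)
    (if ieval (at1 M i) pos == j then reval (at1 M i) E else 0).
suff [_ [_ ->]] : good (ieval M e) (exec (scatter X e pos E) M).1 by [].
apply: (exec_For_ind (I := good)) => [|v M' _ [Hi [Hr HX]]].
  by split=> //; split=> // j'; rewrite big_nil addr0.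
have Hi' a k : imem (iset M' 10 0 v) a k = imem (at1 M v) a k.
  by have := Hi a k; rewrite /at1 /=; case: (_ && _).
have posE := ieval_agree pos Hi'.
have EE : reval (iset M' 10 0 v) E = reval (at1 M v) E.
  by apply: (@similar_eval X).
split=> [a k|]; first by have := Hi a k; rewrite /=; case: (_ && _).
split=> [a i' j' aX|j'] /=; first by rewrite (negPf aX) /= Hr.
rewrite posE EE eqxx big_nat_recr //= andbT.
by rewrite eq_sym; case: eqP => [<-|_]; rewrite HX ?addr0 ?addrA.
Qed.

End Machine.

(** * The pivoting program *)

(** Use of the arrays, beyond the inputs.  Real arrays: 4 the current direction,
    5 the (partial) inverse, 6 to 9 and 14 intermediate results of its
    extension, 15 the multipliers c_B^T A_B^-1, 16 the reduced costs, 17 the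
    entering column, 18 the basic solution, 19 the ratios, 20 the tie-breaking
    quotients.  Natural number arrays: 3 the flag that array 4 is valid, 4 the
    entering index plus one, 5 the leaving row plus one, 10 to 13 counters.  Row
    [k] means the [k]-th element of the basis. *)

Local Notation lit0 := (Iconst 0).
Local Notation lit1 := (Iconst 1).
Local Notation dim_m := (Iget 0 lit0).
Local Notation dim_n := (Iget 0 lit1).
Local Notation basic e := (Iget 1 e).
Local Notation step_ctr := (ctr 13).
Local Notation ent := (Isub (ctr 4) lit1).
Local Notation lea := (Isub (ctr 5) lit1).

(** The flag is 0 in a blank memory, that is, on arrival.  Later array 4 already
    holds the turned direction. *)
Definition copy_direction : cmd :=
  Seq (If (Tile (ctr 3) lit0)
        (fill_sums 4 dim_n lit1 lit0 (Rget 3 row_ctr lit0) Rzero) Skip)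
      (Iset 3 lit0 lit1).

(** [extend_inverse] for the basis matrix, whose entries are read through the
    basis: arrays 6, 7, 8 and 9 receive M a^T, the residue, its product with
    the row a, and e_k - a V. *)
Definition extend_code : cmd :=
  Seq (fill_sums 6 dim_m lit1 dim_m Rzero
        (Rmul (Rget 0 row_ctr (basic sum_ctr))
              (Rget 0 step_ctr (basic sum_ctr))))
  (Seq (fill_sums 7 dim_m lit1 dim_m (Rget 0 step_ctr (basic row_ctr))
        (Rsub Rzero (Rmul (Rget 5 row_ctr sum_ctr) (Rget 6 sum_ctr lit0))))
  (Seq (fill_sums 8 lit1 lit1 dim_m Rzero
        (Rmul (Rget 0 step_ctr (basic sum_ctr)) (Rget 7 sum_ctr lit0)))
  (Seq (fill_sums 9 lit1 dim_m dim_m Rzero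
        (Rsub Rzero (Rmul (Rget 0 step_ctr (basic sum_ctr))
                          (Rget 5 sum_ctr col_ctr))))
  (Seq (Rset 9 lit0 step_ctr (Radd (Rget 9 lit0 step_ctr) Rone))
  (Seq (fill_sums 14 dim_m dim_m lit0
        (Radd (Rget 5 row_ctr col_ctr)
              (Rdiv (Rmul (Rget 7 row_ctr lit0) (Rget 9 lit0 col_ctr))
                    (Rget 8 lit0 lit0))) Rzero)
       (fill_sums 5 dim_m dim_m lit0 (Rget 14 row_ctr col_ctr) Rzero)))))).

Definition invert_code : cmd :=
  Seq (fill_sums 5 dim_m dim_m lit0 Rzero Rzero)
      (For 13 dim_m extend_code).

Definition price_code : cmd :=
  Seq (fill_sums 15 lit1 dim_m dim_m Rzero
        (Rmul (Rget 2 (basic sum_ctr) lit0) (Rget 5 sum_ctr col_ctr)))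
      (fill_sums 16 lit1 dim_n dim_m (Rget 2 col_ctr lit0)
        (Rsub Rzero (Rmul (Rget 15 lit0 sum_ctr) (Rget 0 sum_ctr col_ctr)))).

Definition enter_code : cmd :=
  scan_loop 4 dim_n
    (Tand (Tnot (Trle Rzero (Rget 16 lit0 row_ctr)))
          (Tnot (Trle (Rget 4 row_ctr lit0) Rzero)))
    (Tile lit0 lit0).

Definition column_code : cmd :=
  Seq (fill_sums 17 dim_m lit1 dim_m Rzero
        (Rmul (Rget 5 row_ctr sum_ctr) (Rget 0 sum_ctr ent)))
  (Seq (fill_sums 18 dim_m lit1 dim_m Rzero
        (Rmul (Rget 5 row_ctr sum_ctr) (Rget 1 sum_ctr lit0)))
  (Seq (fill_sums 19 dim_m lit1 lit0
        (Rdiv (Rget 18 row_ctr lit0) (Rget 17 row_ctr lit0)) Rzero)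
       (fill_sums 20 dim_m lit1 lit0
        (Rdiv (Rget 4 (basic row_ctr) lit0) (Rget 17 row_ctr lit0)) Rzero))).

(** The second test is the lexicographic comparison of two values of
    [leave_key]. *)
Definition leave_code : cmd :=
  scan_loop 5 dim_m
    (Tnot (Trle (Rget 17 row_ctr lit0) Rzero))
    (Tand (Trle (Rget 19 lea lit0) (Rget 19 row_ctr lit0))
      (Tnot (Tand (Trle (Rget 19 row_ctr lit0) (Rget 19 lea lit0))
                  (Tnot (Trle (Rget 20 lea lit0) (Rget 20 row_ctr lit0)))))).

Definition output_code : cmd :=
  Seq (Iset 2 lit0 (ctr 4))
      (If (Tile (ctr 5) lit0) (Iset 2 lit1 lit0)
          (Iset 2 lit1 (Iadd (basic lea) lit1))).

(** The edge direction is added in two parts: the column of [Abar] on the basis,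
    and the entry 1 at the entering index. *)
Definition turn_code : cmd :=
  Seq (scatter 4 dim_m (basic row_ctr)
        (Rsub Rzero (Rmul (Rget 20 lea lit0) (Rget 17 row_ctr lit0))))
      (Rset 4 ent lit0 (Radd (Rget 4 ent lit0) (Rget 20 lea lit0))).

Definition pivot_code : cmd :=
  Seq copy_direction (Seq invert_code (Seq price_code (Seq enter_code
    (Seq column_code (Seq leave_code (Seq output_code turn_code)))))).

Section Correctness.
Context {R : realType} {m n : nat}.
Variables (A : 'M[R]_(m, n)) (b : 'cV[R]_m) (c : 'cV[R]_n).
Implicit Types (M : memory R) (B : basis A) (p : cmd).

Definition holds M a r s (X : 'M[R]_(r, s)) : Prop :=
  forall (i : 'I_r) (j : 'I_s), rmem M a i j = X i j.

Definition ready B M : Prop :=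
  [/\ [/\ holds M 0 A, holds M 1 b & holds M 2 c],
      imem M 0 0 = m, imem M 0 1 = n &
      forall k : 'I_m, imem M 1 k = Bidx B k].

Lemma holds_exec p M a r s (X : 'M[R]_(r, s)) :
  a \notin rwrites p -> holds M a X -> holds (exec p M).1 a X.
Proof. by move=> ap H i j; rewrite exec_rframe. Qed.

Lemma holds_col M a r (F : 'I_r -> R) :
  holds M a (\col_k F k) -> forall k : 'I_r, rmem M a k 0 = F k.
Proof. by move=> H k; rewrite (H k 0) mxE. Qed.

Lemma ready_exec B p M :
  [&& 0%N \notin rwrites p, 1%N \notin rwrites p, 2%N \notin rwrites p,
      0%N \notin iwrites p & 1%N \notin iwrites p] ->
  ready B M -> ready B (exec p M).1.
Proof.
case/and5P=> r0 r1 r2 i0 i1 [[? ? ?] ? ? ?]; split; rewrite ?exec_iframe //.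
  by split; apply: holds_exec.
by move=> k; rewrite exec_iframe.
Qed.

(** [fill_sumsP] for a target given as a matrix. *)
Lemma fill_sums_holds X e1 e2 e3 E0 E M r s (F : 'M[R]_(r, s)) :
  [&& is_bound e1, is_bound e2, is_bound e3, X \notin rreads E0 &
      X \notin rreads E] ->
  ieval M e1 = r -> ieval M e2 = s ->
  (forall (i : 'I_r) (j : 'I_s), reval (at3 M i j 0) E0 +
     \sum_(l < ieval M e3) reval (at3 M i j l) E = F i j) ->
  holds (exec (fill_sums X e1 e2 e3 E0 E) M).1 X F.
Proof.
case/and5P=> b1 b2 b3 XE0 XE er es FE i j.
by rewrite fill_sumsP ?er ?es // big_mkord FE.
Qed.

Lemma extend_codeP B M (V : 'M[R]_m) (k : 'I_m) :
  ready B M -> imem M 13 0 = k -> holds M 5 V ->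
  holds (exec extend_code M).1 5 (extend_inverse (bmx B) V k).
Proof.
move=> rM kM VM; rewrite /extend_code.
rewrite exec_Seq; set M1 := (exec (fill_sums 6 _ _ _ _ _) M).1.
have r1 : ready B M1 by apply: ready_exec rM.
have k1 : imem M1 13 0 = k by rewrite exec_iframe.
have V1 : holds M1 5 V by apply: holds_exec VM.
have u1 : holds M1 6 (bmx B *m (row k (bmx B))^T).
  case: rM => -[A0 _ _] mM nM BM; apply: fill_sums_holds => //= i j.
  rewrite add0r mM mxE; apply: eq_bigr => l _.
  by rewrite kM BM !A0 !mxE.
rewrite exec_Seq; set M2 := (exec (fill_sums 7 _ _ _ _ _) M1).1.
have r2 : ready B M2 by apply: ready_exec r1.
have k2 : imem M2 13 0 = k by rewrite exec_iframe.
have V2 : holds M2 5 V by apply: holds_exec V1.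
have p2 : holds M2 7 (residue (bmx B) V k).
  case: r1 => -[A0 _ _] mM nM BM; apply: fill_sums_holds => //= i j.
  rewrite mM k1 BM A0 /residue (ord1 j) !mxE -sumrN; congr (_ + _).
  by apply: eq_bigr => l _; rewrite V1 (u1 l 0) sub0r.
rewrite exec_Seq; set M3 := (exec (fill_sums 8 _ _ _ _ _) M2).1.
have r3 : ready B M3 by apply: ready_exec r2.
have k3 : imem M3 13 0 = k by rewrite exec_iframe.
have V3 : holds M3 5 V by apply: holds_exec V2.
have p3 : holds M3 7 (residue (bmx B) V k) by apply: holds_exec p2.
have d3 : holds M3 8 (row k (bmx B) *m residue (bmx B) V k).
  case: r2 => -[A0 _ _] mM nM BM; apply: fill_sums_holds => //= i j.
  rewrite add0r mM mxE; apply: eq_bigr => l _.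
  by rewrite k2 BM A0 (p2 l 0) (ord1 j); congr (_ * _); rewrite !mxE.
rewrite exec_Seq; set M4 := (exec (fill_sums 9 _ _ _ _ _) M3).1.
have r4 : ready B M4 by apply: ready_exec r3.
have k4 : imem M4 13 0 = k by rewrite exec_iframe.
have V4 : holds M4 5 V by apply: holds_exec V3.
have p4 : holds M4 7 (residue (bmx B) V k) by apply: holds_exec p3.
have d4 : holds M4 8 (row k (bmx B) *m residue (bmx B) V k).
  by apply: holds_exec d3.
have q4 : holds M4 9 (- (row k (bmx B) *m V)).
  case: r3 => -[A0 _ _] mM nM BM; apply: fill_sums_holds => //= i j.
  rewrite add0r mM mxE mxE -sumrN; apply: eq_bigr => l _.
  by rewrite k3 BM A0 !mxE V3 sub0r.
rewrite exec_Seq; set M5 := (exec (Rset 9 _ _ _) M4).1.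
have r5 : ready B M5 by apply: ready_exec r4.
have V5 : holds M5 5 V by apply: holds_exec V4.
have p5 : holds M5 7 (residue (bmx B) V k) by apply: holds_exec p4.
have d5 : holds M5 8 (row k (bmx B) *m residue (bmx B) V k).
  by apply: holds_exec d4.
have q5 : holds M5 9 (delta_mx 0 k - row k (bmx B) *m V).
  move=> i j; rewrite /M5 /= k4 (ord1 i) (q4 0 k) (q4 0 j) /=.
  rewrite [RHS]mxE [X in _ = X + _]mxE eqxx /= addrC -val_eqE /=.
  by case: eqP => [/ord_inj ->|]; rewrite ?add0r // addrC.
clearbody M5; rewrite exec_Seq; set M6 := (exec (fill_sums 14 _ _ _ _ _) M5).1.
have r6 : ready B M6 by apply: ready_exec r5.
have W6 : holds M6 14 (extend_inverse (bmx B) V k).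
  case: r5 => -[A0 _ _] mM nM BM; apply: fill_sums_holds => //= i j.
  rewrite big_ord0 addr0 V5 (p5 i 0) (q5 0 j) (d5 0 0).
  rewrite /extend_inverse [RHS]mxE; congr (_ + _).
  by rewrite [RHS]mxE [(_ *m (_ - _)) i j]mxE big_ord1 mulrC.
case: r6 => -[A0 _ _] mM nM BM; apply: fill_sums_holds => //= i j.
by rewrite big_ord0 addr0 W6.
Qed.

Lemma invert_codeP B M :
  ready B M -> holds (exec invert_code M).1 5 (invmx (bmx B)).
Proof.
move=> rM; rewrite /invert_code exec_Seq.
set M1 := (exec (fill_sums 5 _ _ _ _ _) M).1.
have r1 : ready B M1 by apply: ready_exec rM.
pose good v M' := ready B M' /\
  exists2 V, partial_inverse (bmx B) v V & holds M' 5 V.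
suff [_ [V VP VM]] : good m (exec (For 13 dim_m extend_code) M1).1.
  by rewrite -(partial_inverse_full (bnonsing B) VP).
have m1 : ieval M1 dim_m = m by case: r1.
rewrite -{1}m1.
apply: (exec_For_ind (I := good)) => [|v M' lt_v [rM' [V VP VM]]].
  split=> //; exists 0; first exact: partial_inverse0.
  case: rM => _ mM _ _; apply: fill_sums_holds => //= i j.
  by rewrite big_ord0 addr0 mxE.
rewrite m1 in lt_v.
have r2 : ready B (iset M' 13 0 v) by [].
split; first exact: ready_exec r2.
exists (extend_inverse (bmx B) V (Ordinal lt_v)).
  exact: (@partial_inverse_step _ _ _ (bnonsing B) _ (Ordinal lt_v)).
exact: extend_codeP.
Qed.

Lemma price_codeP B M :
  ready B M -> holds M 5 (invmx (bmx B)) ->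
  holds (exec price_code M).1 16 (redcost c B).
Proof.
move=> rM VM; rewrite /price_code exec_Seq.
set M1 := (exec (fill_sums 15 _ _ _ _ _) M).1.
have r1 : ready B M1 by apply: ready_exec rM.
have pi1 : holds M1 15 (colsub (Bidx B) c^T *m invmx (bmx B)).
  case: rM => -[_ _ c0] mM nM BM; apply: fill_sums_holds => //= i j.
  rewrite add0r mM mxE; apply: eq_bigr => l _.
  by rewrite BM (c0 _ 0) VM !mxE (ord1 i).
have -> : redcost c B = c^T - (colsub (Bidx B) c^T *m invmx (bmx B)) *m A.
  by rewrite /redcost mulmx_pad mulmxA.
case: r1 => -[A0 _ c0] mM nM BM; apply: fill_sums_holds => //= i j.
rewrite mM mxE (c0 j 0) [X in _ = X + _]mxE (ord1 i) [X in _ = _ + X]mxE.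
rewrite [X in _ = _ - X]mxE -sumrN; congr (_ + _); apply: eq_bigr => l _.
by rewrite (pi1 0 l) A0 sub0r.
Qed.

Lemma enter_codeP B M (y : 'cV[R]_n) :
  ready B M -> holds M 16 (redcost c B) -> holds M 4 y ->
  imem (exec enter_code M).1 4 0 = onat (entering c y B).
Proof.
move=> rM rcM yM; have nM : ieval M dim_n = n by case: rM.
apply: scan_loopP => // [o k|k l]; last by rewrite lexx.
by rewrite /= (rcM 0 k) (yM k 0) -!ltNge.
Qed.

Lemma Abar_BidxE B k f :
  Abar B (Bidx B k) f = \sum_l invmx (bmx B) k l * A l f.
Proof. by rewrite pad_in mxE. Qed.

Lemma column_codeP B M (y : 'cV[R]_n) (f : 'I_n) :
  ready B M -> holds M 5 (invmx (bmx B)) -> holds M 4 y -> imem M 4 0 = f.+1 ->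
  let M' := (exec column_code M).1 in
  [/\ holds M' 17 (\col_k Abar B (Bidx B k) f),
      holds M' 19 (\col_k ratio b B f (Bidx B k)) &
      holds M' 20 (\col_k (y (Bidx B k) 0 / Abar B (Bidx B k) f))].
Proof.
move=> rM VM yM fM; rewrite /column_code.
rewrite exec_Seq; set M1 := (exec (fill_sums 17 _ _ _ _ _) M).1.
have r1 : ready B M1 by apply: ready_exec rM.
have V1 : holds M1 5 (invmx (bmx B)) by apply: holds_exec VM.
have y1 : holds M1 4 y by apply: holds_exec yM.
have a1 : holds M1 17 (\col_k Abar B (Bidx B k) f).
  case: rM => -[A0 _ _] mM nM BM; apply: fill_sums_holds => //= i j.
  rewrite add0r mM mxE Abar_BidxE; apply: eq_bigr => l _.
  by rewrite VM fM subn1 A0.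
rewrite exec_Seq; set M2 := (exec (fill_sums 18 _ _ _ _ _) M1).1.
have r2 : ready B M2 by apply: ready_exec r1.
have y2 : holds M2 4 y by apply: holds_exec y1.
have a2 : holds M2 17 (\col_k Abar B (Bidx B k) f) by apply: holds_exec a1.
have x2 : holds M2 18 (\col_k bsol b B (Bidx B k) 0).
  case: r1 => -[_ b0 _] mM nM BM; apply: fill_sums_holds => //= i j.
  rewrite add0r mM mxE pad_in mxE; apply: eq_bigr => l _.
  by rewrite V1 (b0 l 0).
rewrite exec_Seq; set M3 := (exec (fill_sums 19 _ _ _ _ _) M2).1.
have r3 : ready B M3 by apply: ready_exec r2.
have y3 : holds M3 4 y by apply: holds_exec y2.
have a3 : holds M3 17 (\col_k Abar B (Bidx B k) f) by apply: holds_exec a2.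
have t3 : holds M3 19 (\col_k ratio b B f (Bidx B k)).
  case: r2 => _ mM nM BM; apply: fill_sums_holds => //= i j.
  by rewrite big_ord0 addr0 (ord1 j) mxE (holds_col x2) (holds_col a2).
split; [exact: holds_exec a3 | exact: holds_exec t3 | ].
case: r3 => _ mM nM BM; apply: fill_sums_holds => //= i j.
by rewrite big_ord0 addr0 BM (y3 _ 0) (holds_col a3) [RHS]mxE.
Qed.

Lemma leave_codeP B M (y : 'cV[R]_n) (f : 'I_n) :
  ready B M ->
  holds M 17 (\col_k Abar B (Bidx B k) f) ->
  holds M 19 (\col_k ratio b B f (Bidx B k)) ->
  holds M 20 (\col_k (y (Bidx B k) 0 / Abar B (Bidx B k) f)) ->
  imem (exec leave_code M).1 5 0 =
  onat (scan (fun k => 0 < Abar B (Bidx B k) f) (leave_key b y B f)).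
Proof.
move=> rM aM rtM tM; have mM : ieval M dim_m = m by case: rM.
apply: scan_loopP => // [o k|k l]; first by rewrite /= (holds_col aM) -ltNge.
rewrite /= subn1 /= !(holds_col rtM) !(holds_col tM) lexi_pair.
by rewrite implybE negb_and negbK.
Qed.

Lemma turn_codeP B M (y : 'cV[R]_n) (f : 'I_n) (l : 'I_m) :
  ready B M -> holds M 4 y -> imem M 4 0 = f.+1 -> imem M 5 0 = l.+1 ->
  holds M 17 (\col_k Abar B (Bidx B k) f) ->
  holds M 20 (\col_k (y (Bidx B k) 0 / Abar B (Bidx B k) f)) ->
  holds (exec turn_code M).1 4 (turn y B f (Bidx B l)).
Proof.
move=> rM yM fM lM aM tM i j; rewrite (ord1 j) turnE.
set al := y (Bidx B l) 0 / _.
have scE (h : 'I_n) : rmem (exec (scatter 4 dim_m (basic row_ctr)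
    (Rsub Rzero (Rmul (Rget 20 lea lit0) (Rget 17 row_ctr lit0)))) M).1 4 h 0 =
    y h 0 - al * Abar B h f.
  case: rM => _ mM _ BM.
  rewrite scatterP // (yM h 0) /= mM big_mkord padE mulr_sumr -sumrN.
  congr (_ + _); apply: eq_bigr => k _.
  rewrite BM lM subn1 /= (holds_col tM) (holds_col aM) sub0r -/al pad_in.
  rewrite [Bidx B k == h]/eq_op /=.
  by case: eqP => _; rewrite ?mul1r ?mul0r ?mulr0 ?oppr0.
rewrite /turn_code exec_Seq; set M1 := (exec (scatter _ _ _ _) M).1.
have f1 : imem M1 4 0 = f.+1 by rewrite exec_iframe.
have l1 : imem M1 5 0 = l.+1 by rewrite exec_iframe.
have t1 : rmem M1 20 l 0 = al by rewrite exec_rframe // (holds_col tM).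
rewrite /= f1 l1 !subn1 /= t1 !scE val_eqE andbT mulrBr.
case: eqP => [->|_]; last by rewrite mulr0 sub0r.
by rewrite mulr1 -addrA [- _ + _]addrC.
Qed.

Lemma copy_directionP B M (y : 'cV[R]_n) :
  ready B M ->
  (if imem M 3 0 == 0%N then holds M 3 y else holds M 4 y) ->
  holds (exec copy_direction M).1 4 y.
Proof.
move=> rM yM; rewrite /copy_direction exec_Seq exec_If [teval _ _]/= leqn0.
case: eqP yM => _ yM; last by [].
case: rM => _ _ nM _; apply: (holds_exec (p := Iset 3 lit0 lit1)) => //.
apply: fill_sums_holds => //= i j.
by rewrite big_ord0 addr0 (yM i 0) (ord1 j).
Qed.

Lemma output_codeP M :
  imem (exec output_code M).1 2 0 = imem M 4 0 /\
  imem (exec output_code M).1 2 1 =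
    if imem M 5 0 is k.+1 then (imem M 1 k).+1 else 0%N.
Proof.
rewrite /output_code exec_Seq exec_If /=.
by case E: (imem M 5 0) => [|k] /=; rewrite ?E ?subn1 ?addn1.
Qed.

Lemma pivot_codeP B M (y : 'cV[R]_n) (f : 'I_n) :
  ready B M ->
  (if imem M 3 0 == 0%N then holds M 3 y else holds M 4 y) ->
  entering c y B = Some f ->
  let M' := (exec pivot_code M).1 in
  [/\ imem M' 2 0 = f.+1, imem M' 2 1 = onat (leaving b y B f),
      imem M' 3 0 = 1%N &
      forall i, leaving b y B f = Some i -> holds M' 4 (turn y B f i)].
Proof.
move=> rM yM fE; rewrite /pivot_code.
rewrite exec_Seq; set M1 := (exec copy_direction M).1.
have r1 : ready B M1 by apply: ready_exec rM.
have y1 : holds M1 4 y by exact: copy_directionP rM yM.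
have c1 : imem M1 3 0 = 1%N by [].
rewrite exec_Seq; set M2 := (exec invert_code M1).1.
have r2 : ready B M2 by apply: ready_exec r1.
have y2 : holds M2 4 y by apply: holds_exec y1.
have c2 : imem M2 3 0 = 1%N by rewrite exec_iframe.
have V2 : holds M2 5 (invmx (bmx B)) by apply: invert_codeP r1.
rewrite exec_Seq; set M3 := (exec price_code M2).1.
have r3 : ready B M3 by apply: ready_exec r2.
have y3 : holds M3 4 y by apply: holds_exec y2.
have c3 : imem M3 3 0 = 1%N by rewrite exec_iframe.
have V3 : holds M3 5 (invmx (bmx B)) by apply: holds_exec V2.
have rc3 : holds M3 16 (redcost c B) by apply: price_codeP r2 V2.
rewrite exec_Seq; set M4 := (exec enter_code M3).1.
have r4 : ready B M4 by apply: ready_exec r3.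
have y4 : holds M4 4 y by apply: holds_exec y3.
have c4 : imem M4 3 0 = 1%N by rewrite exec_iframe.
have V4 : holds M4 5 (invmx (bmx B)) by apply: holds_exec V3.
have f4 : imem M4 4 0 = f.+1 by rewrite (enter_codeP r3 rc3 y3) fE.
rewrite exec_Seq; set M5 := (exec column_code M4).1.
have r5 : ready B M5 by apply: ready_exec r4.
have y5 : holds M5 4 y by apply: holds_exec y4.
have c5 : imem M5 3 0 = 1%N by rewrite exec_iframe.
have f5 : imem M5 4 0 = f.+1 by rewrite exec_iframe.
have [a5 t5 u5] := column_codeP r4 V4 y4 f4; rewrite -/M5 in a5 t5 u5.
rewrite exec_Seq; set M6 := (exec leave_code M5).1.
have r6 : ready B M6 by apply: ready_exec r5.
have y6 : holds M6 4 y by apply: holds_exec y5.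
have c6 : imem M6 3 0 = 1%N by rewrite exec_iframe.
have f6 : imem M6 4 0 = f.+1 by rewrite exec_iframe.
have a6 : holds M6 17 (\col_k Abar B (Bidx B k) f) by apply: holds_exec a5.
have u6 : holds M6 20 (\col_k (y (Bidx B k) 0 / Abar B (Bidx B k) f)).
  by apply: holds_exec u5.
have l6 := leave_codeP r5 a5 t5 u5; rewrite -/M6 in l6.
rewrite exec_Seq; set M7 := (exec output_code M6).1.
have r7 : ready B M7 by apply: ready_exec r6.
have y7 : holds M7 4 y by apply: holds_exec y6.
have c7 : imem M7 3 0 = 1%N by rewrite exec_iframe.
have f7 : imem M7 4 0 = f.+1 by rewrite exec_iframe.
have a7 : holds M7 17 (\col_k Abar B (Bidx B k) f) by apply: holds_exec a6.
have u7 : holds M7 20 (\col_k (y (Bidx B k) 0 / Abar B (Bidx B k) f)).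
  by apply: holds_exec u6.
have l7 : imem M7 5 0 = imem M6 5 0 by rewrite exec_iframe.
have out7 : imem M7 2 0 = f.+1 /\ imem M7 2 1 = onat (leaving b y B f).
  have [-> ->] := output_codeP M6; rewrite f6 l6 /leaving; split=> //.
  case: r6 => _ _ _ BM; case: scan => [k|] //.
  by rewrite -[LHS]/(imem M6 1 k).+1 BM.
case: out7 => enter7 leave7.
split; [by rewrite exec_iframe.. |].
move=> i; rewrite /leaving.
move: l6; case: scan => [k|] // l6 [<-].
by apply: (turn_codeP r7 y7 f7 _ a7 u7); rewrite l7 l6.
Qed.

Lemma entryE (p q : nat) (X : 'M[R]_(p, q)) (i : 'I_p) (j : 'I_q) :
  entry X i j = X i j.
Proof. by rewrite /entry !valK. Qed.

Lemma ready_load B (y : 'cV[R]_n) M :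
  ready B (@load _ _ _ A b c B y M) /\ holds (@load _ _ _ A b c B y M) 3 y.
Proof.
split; last by move=> i j; rewrite /= entryE.
split=> //; first by split=> i j; rewrite /= entryE.
by move=> k; rewrite /= valK.
Qed.

(** * Correctness over a visit *)

Section Visit.
Variable dir : 'cV[R]_n -> 'cV[R]_n.
Notation rule := (turning_rule A b c dir).

Lemma arrival_None B (s : info rule) : arrival B s -> s = None.
Proof.
by case=> // {}B {}s B' r _; apply: update_nondegenerate.
Qed.

(** What the memory left by the previous iterations says about the information
    of the rule. *)
Definition stored (s : option 'cV[R]_n) M : Prop :=
  if s is Some y then imem M 3 0 = 1%N /\ holds M 4 y else imem M 3 0 = 0%N.

(** One iteration gives the answers of the rule and, if the next pivot is
    degenerate, re-establishes the invariant [stored]. *)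
Lemma iterateP x B (s : info rule) M :
  descent A c x (dir x) -> bsol b B = x ->
  descent A c (bsol b B) (current b c dir B s) -> stored s M ->
  let M' := (@iterate _ _ _ A b c pivot_code B (dir x) M).1 in
  [/\ imem M' 2 0 = onat (enter B s), imem M' 2 1 = onat (leave B s) &
      forall B', simplex_step B s B' 0 -> stored (update B s) M'].
Proof.
move=> dx Bx dB sM.
have [f fE _] := entering_descent dB.
have eE : enter B s = Some f by rewrite /= /rule_enter /enter_any fE.
have lvE : leave B s = leaving b (current b c dir B s) B f.
  by rewrite /= /rule_leave /rule_enter /enter_any fE.
have [rM yM] := ready_load B (dir x) M.
have [] := pivot_codeP (y := current b c dir B s) rM _ fE.
  case: s sM {dB fE eE lvE} => [y [sM yM']|sM]; rewrite [imem _ 3 0]sM //=.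
  by rewrite /first_direction Bx dx.
move=> oE lE cE tE; split.
- by rewrite eE; exact: oE.
- by rewrite lvE; exact: lE.
move=> B' st; have [g [i [gE iE _ _ ->]]] := degenerate_step_descent dB st.
have gf : g = f by move: gE; rewrite fE => -[].
by rewrite gf in iE *; split; [exact: cE | exact: tE].
Qed.

Lemma visit_stored x B (s : info rule) M :
  descent A c x (dir x) -> visit pivot_code (dir x) x B s M ->
  [/\ bsol b B = x, descent A c (bsol b B) (current b c dir B s) & stored s M].
Proof.
move=> dx; elim=> [{}B {}s aB Bx|{}B {}s {}M B' vis [Bx dB sM] st].
  rewrite (arrival_None aB) Bx; split=> //.
  by rewrite /= /first_direction Bx dx.
split; first by rewrite (degenerate_bsol st).
  exact: degenerate_step_current.
by have [_ _ /(_ B' st)] := iterateP dx Bx dB sM.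
Qed.

End Visit.
End Correctness.

Theorem theorem1 :
  exists (code : cmd) (C d : nat),
  forall (R : realType) (m n : nat)
         (A : 'M[R]_(m, n)) (b : 'cV[R]_m) (c : 'cV[R]_n),
  \rank A = m ->
  exists rule : ('cV[R]_n -> 'cV[R]_n) -> pivot_rule A b c,
  forall dir : 'cV[R]_n -> 'cV[R]_n,
    (forall x : 'cV[R]_n, extreme_point A b x -> ~ lp_optimal A b c x ->
     forall (B : basis A) (s : info (rule dir)) (k : nat),
       reachable B s -> bsol b B = x -> degenerate_pivots k B s ->
       (k <= n - m - 1)%N) /\
    (forall x : 'cV[R]_n, extreme_point A b x -> ~ lp_optimal A b c x ->
     improving_direction A c x (dir x) ->
     implements_at (rule dir) code (dir x) x (C * (n + m).+1 ^ d)%N).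
Proof.
exists pivot_code, (text_size pivot_code), (loop_depth pivot_code).
move=> R m n A b c _; exists (turning_rule A b c) => dir; split.
  move=> x [xP _] xN B s k rB Bx dk; rewrite -Bx in xP xN.
  have := degenerate_pivots_nonbasic_support (reachable_descent rB xP xN) dk.
  move/leq_trans/(_ (nonbasic_support_le _ B)); rewrite subn1.
  by case: (n - m)%N.
move=> x _ _ /improving_descent dx B s M vis out.
have [Bx dB sM] := visit_stored dx vis.
have [oE lE _] := iterateP dx Bx dB sM; split=> //.
apply: exec_cost => // k; rewrite /=.
case: k => [|[|k]] /=; last by rewrite nth_nil.
  by rewrite leqW // leq_addl.
by rewrite leqW // leq_addr.
Qed.
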